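(* In the sparse clustering model described in the context, there exists an estimator $\hat G$ (not necessarily computable in polynomial time) such that, for every $a>0$, there exist constants $C,C'>0$ depending only on $a$ for which the following holds. Assume that $X$ is $\eta$-homogeneous and $G^*$ is $\gamma$-balanced with $\eta,\gamma\le a\log^a(np)$. If $$\Delta^2\ \ge\ C\log^{C'}(np)\left(1+\sqrt{\frac{sK}{n}}+\frac{s\sqrt K}{n}\right),$$ then $\hat G=G^*$ with probability at least $1-4/n^2$.
   Context: Sparse clustering model: $s\in[p]$ is known; there is an unknown $J^*\subseteq[p]$ with $|J^*|\le s$ such that the unknown means $\mu_1,\dots,\mu_K\in\mathbb R^p$ ($K\ge2$) are all supported on $J^*$ ($\mu_{kj}=0$ for $j\notin J^*$). For some $\sigma>0$ and an unknown partition $G^*=\{G_1^*,\dots,G_K^*\}$ of $[n]$, the rows $Y_1,\dots,Y_n\in\mathbb R^p$ of $Y$ are independent, with $Y_i\sim\mathcal N(\mu_k,\sigma^2I_p)$ for $i\in G_k^*$. $X=\mathbb E[Y]$, i.e. $X_{ij}=\mu_{kj}$ for $i\in G_k^*$. $\Delta^2=\min_{k\ne l}\frac{\|\mu_k-\mu_l\|^2}{2\sigma^2}$. $G^*$ is $\gamma$-balanced ($\gamma\ge1$) if $\max_k|G_k^*|/\min_k|G_k^*|\le\gamma$. $X$ is $\eta$-homogeneous ($\eta\ge1$) if $\max_{j\in J^*}\|X_{:j}\|^2\le\eta\,\min_{j\in J^*}\|X_{:j}\|^2$ with the minimum positive, $X_{:j}$ being the $j$-th column of $X$. An estimator is a (measurable)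 map of the data $Y$, possibly using auxiliary randomness independent of the data, with values in the partitions of $[n]$ into $K$ groups; $\hat G=G^*$ means equality as unlabelled partitions. *)

(* Defs.v *)
From HB Require Import structures.
From mathcomp Require Import all_boot all_order all_algebra.
From mathcomp Require Import all_classical all_reals all_analysis.
Set Implicit Arguments.
Unset Strict Implicit.
Unset Printing Implicit Defensive.
Import Order.TTheory GRing.Theory Num.Theory.
Local Open Scope classical_set_scope.
Local Open Scope ring_scope.

Section Probability.
Context {d : measure_display} {Omega : measurableType d} {R : realType}.
Variable P : probability Omega R.

Definition mutually_independent {d' : measure_display}
    {T : measurableType d'} {I : finType} (Z : I -> Omega -> T) : Prop :=
  forall (S : {set I}) (A : I -> set T), (forall i, measurable (A i)) ->
    P (\bigcap_(i in [set` S]) (Z i @^-1` A i)) =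
    (\prod_(i in S) P (Z i @^-1` A i))%E.

Definition independent2 {d1 d2 : measure_display} {T1 : measurableType d1}
    {T2 : measurableType d2} (Z1 : Omega -> T1) (Z2 : Omega -> T2) : Prop :=
  forall (A : set T1) (B : set T2), measurable A -> measurable B ->
    P ((Z1 @^-1` A) `&` (Z2 @^-1` B)) =
    (P (Z1 @^-1` A) * P (Z2 @^-1` B))%E.

(* Z ~ N(m, sigma^2 I_p): the law of Z is the product of the N(m_j, sigma^2),
   a product measure being characterized by its values on measurable boxes.
   The second parameter of normal_prob is the standard deviation. *)
Definition isotropic_gaussian {p : nat} (Z : Omega -> p.-tuple R)
    (m : 'I_p -> R) (sigma : R) : Prop :=
  forall A : 'I_p -> set R, (forall j, measurable (A j)) ->
    P [set w | forall j, A j (tnth (Z w) j)] =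
    (\prod_(j < p) normal_prob (m j) sigma (A j))%E.

End Probability.

Section Clustering.
Context {R : realType} {n p K : nat}.

Definition blocks (G : 'I_K -> {set 'I_n}) : {set {set 'I_n}} :=
  [set G k | k : 'I_K]%SET.

(* Injectivity makes the K blocks pairwise distinct. They are nonempty by
   partition. *)
Definition labelled_partition (G : 'I_K -> {set 'I_n}) : Prop :=
  finset.partition (blocks G) [set: 'I_n]%SET /\ injective G.

(* When G is a labelled partition, exactly one term of the sum is present. *)
Definition mean_matrix (mu : 'M[R]_(K, p)) (G : 'I_K -> {set 'I_n}) :
    'M[R]_(n, p) :=
  \matrix_(i, j) \sum_(k < K | i \in G k) mu k j.

(* Below, max and min of finite families are written sup and inf; they are
   attained as soon as the family is nonempty. *)

Definition separation2 (mu : 'M[R]_(K, p)) (sigma : R) : R :=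
  inf [set (\sum_(j < p) (mu kl.1 j - mu kl.2 j) ^+ 2) / (2 * sigma ^+ 2)
      | kl in [set kl : 'I_K * 'I_K | kl.1 != kl.2]].

Definition balanced (G : 'I_K -> {set 'I_n}) (gamma : R) : Prop :=
  sup (range (fun k => #|G k|%:R : R)) / inf (range (fun k => #|G k|%:R : R))
    <= gamma.

Definition col_norm2 (X : 'M[R]_(n, p)) (j : 'I_p) : R :=
  \sum_(i < n) X i j ^+ 2.

(* Since inf set0 = 0, positivity of the minimum forces J to be nonempty. *)
Definition homogeneous (X : 'M[R]_(n, p)) (J : {set 'I_p}) (eta : R) : Prop :=
  0 < inf [set col_norm2 X j | j in [set` J]] /\
  sup [set col_norm2 X j | j in [set` J]] <=
    eta * inf [set col_norm2 X j | j in [set` J]].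

End Clustering.

(* The row Y_i of the data Y : n.-tuple (p.-tuple R) is tnth Y i; tuples carry
   the sigma-algebra generated by the coordinates. *)
Definition sparse_clustering_model {d : measure_display}
    {Omega : measurableType d} {R : realType} (P : probability Omega R)
    {n p K : nat} (s : nat) (Y : {RV P >-> n.-tuple (p.-tuple R)})
    (sigma : R) (J : {set 'I_p}) (mu : 'M[R]_(K, p))
    (G : 'I_K -> {set 'I_n}) : Prop :=
  [/\ labelled_partition G,
      (#|J| <= s)%N /\ (forall k j, j \notin J -> mu k j = 0),
      mutually_independent P (fun (i : 'I_n) w => tnth (Y w) i)
    & forall (k : 'I_K) (i : 'I_n), i \in G k ->
        isotropic_gaussian P (fun w => tnth (Y w) i) (mu k) sigma].

(* A possibly randomized estimator of a partition of [n] into K groups. The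
   set of values is finite, so measurability of the fibres is measurability. *)
Record estimator (R : realType) (n p K : nat) := Estimator {
  aux_display : measure_display;
  aux : measurableType aux_display;
  aux_law : probability aux R;
  est :> n.-tuple (p.-tuple R) * aux -> {set {set 'I_n}};
  est_measurable : forall Q, measurable [set x | est x = Q];
  est_partition : forall x, finset.partition (est x) [set: 'I_n]%SET /\
    #|est x| = K
}.

(* Main.v *)
(* Encode a labelling [g] of the rows by the projection [P_g] onto the vectors
   that are constant on its blocks. The estimator maximizes, over the labellings
   [g] and the sets [A] of at most [s] columns, the sum over [j] in [A] of
   [|P_g Y_j|^2 - theta |Y_{j0}|^2], where [j0] is the column of smallest norm
   and [theta |Y_{j0}|^2] slightly exceeds [K sigma^2].

   Let [h] be the true labelling. For a single column, [|P_h Y_j|^2] deviates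
   from [K sigma^2] by [sqrt K sigma^2] up to logarithms, whereas homogeneity
   gives every column of [J] a squared norm of at least [sqrt K sigma^2] times a
   large power of the logarithm, because [Delta^2 >> s sqrt K / n]. So a
   maximizer [(g, A)] with [q] wrongly selected columns must satisfy
   [sum_(j in A) Y_j^T (P_g - P_h) Y_j >= c q sqrt K sigma^2]. This Gaussian
   quadratic form has a mean of at most [- |(1 - P_g) X_A|^2] and a variance
   proxy of [s |P_g - P_h|_F^2 + |(1 - P_g) X_A|^2 / sigma^2]. When [g] differs
   from [h], up to a permutation of the labels, at [m] points,
   [|(1 - P_g) X|^2 >= m Delta^2 sigma^2 / (2 gamma)] and
   [|P_g - P_h|_F^2 <= 12 gamma m K / n] are both linear in [m], so one parameter
   in Chernoff's bound serves all pairs [(g, A)] and gives each of them a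
   probability of at most [(n p)^(-8 (m + q))]. These weights are products over
   the points and the columns, and their sum over all [(g, A)] factorizes. *)
From HB Require Import structures.
Require Import Defs.
From mathcomp Require Import all_boot all_order all_algebra.
From mathcomp Require Import all_classical all_reals all_analysis.
From mathcomp Require Import measurable_realfun charge ring lra zify.
Set Implicit Arguments.
Unset Strict Implicit.
Unset Printing Implicit Defensive.
Import Order.TTheory GRing.Theory Num.Theory.
Local Open Scope classical_set_scope.
Local Open Scope ring_scope.

(** The two non-constant terms of the separation condition come from the two summands of the
    Chernoff parameter, up to logarithms. Charging a logarithm to every wrong column needs a
    parameter of order [1 / sqrt K], and the variance is then dominated once [Delta^2] exceeds
    [s sqrt K / n]. Charging a logarithm to every misclassified point needs a parameter of order
    [1 / Delta^2], and the variance is then dominated once [Delta^4] exceeds [s K / n]; hence the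
    square root. A maximizer that omits columns of [J] sees only part of the separation, since
    [|(1 - P_g) X_A|^2] may be far below [|(1 - P_g) X|^2]. The difference is at most the energy of
    the omitted columns, and the gain by which the labelling must make up for the omission contains
    a fixed fraction of that energy; together they restore the full separation. The majority map
    from candidate blocks to true classes need not be injective. Balance ensures that turning it
    into a permutation multiplies the number of errors by at most [1 + gamma]. *)

(** * Laplace transforms of Gaussian quadratic forms *)

Section normal_integral.
Context {R : realType}.
Implicit Types m s mu beta : R.

Lemma integral_normal_prob m s (f : R -> \bar R) :
  measurable_fun setT f -> (forall x, 0 <= f x)%E ->
  (\int[normal_prob m s]_x f x =
   \int[lebesgue_measure]_x (f x * (normal_pdf m s x)%:E))%E.
Proof.
move=> mf f0; have dom := @normal_prob_dominates R m s.
have mpdf : measurable_fun setT (fun x => (normal_pdf m s x)%:E).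
  by apply/measurable_EFinP; exact: measurable_normal_pdf.
have mRN := measurable_int _ (Radon_Nikodym_SigmaFinite.f_integrable dom).
rewrite -(Radon_Nikodym_SigmaFinite.change_of_variables dom)//.
apply: ae_eq_integral => //; [exact: emeasurable_funM..|].
apply: ae_eqe_mul2l; apply: integral_ae_eq => //.
  exact: Radon_Nikodym_SigmaFinite.f_integrable dom.
by move=> E _ mE; rewrite -(Radon_Nikodym_SigmaFinite.f_integral dom mE).
Qed.

(** Completing the square: the exponential factor multiplies the precision by [mu] and shifts the
    mean. *)
Lemma normal_pdf_tilt m s mu beta t : 0 < s -> 0 < mu ->
  expR ((1 - mu) / 2 * ((t - m) / s) ^+ 2 + beta * ((t - m) / s))
    * normal_pdf m s t =
  (Num.sqrt mu)^-1 * expR (beta ^+ 2 / (2 * mu)) *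
    normal_pdf (m + s * beta / mu) (s / Num.sqrt mu) t.
Proof.
move=> s0 mu0; have q0 : 0 < Num.sqrt mu by rewrite sqrtr_gt0.
have sq : s / Num.sqrt mu != 0 by rewrite gt_eqF// divr_gt0.
rewrite !normal_pdfE ?gt_eqF// ?divr_gt0//.
have -> : normal_peak (s / Num.sqrt mu) = Num.sqrt mu * normal_peak s.
  rewrite /normal_peak expr_div_n sqr_sqrtr ?ltW//.
  have -> : s ^+ 2 / mu * pi *+ 2 = (s ^+ 2 * pi *+ 2) * mu^-1 by ring.
  have A0 : 0 <= s ^+ 2 * pi *+ 2 by rewrite mulrn_wge0// mulr_ge0 ?sqr_ge0 ?pi_ge0.
  by rewrite (sqrtrM _ A0) sqrtrV ?(ltW mu0)// invfM invrK mulrC.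
have E2 : (s / Num.sqrt mu) ^+ 2 = s ^+ 2 / mu.
  by rewrite expr_div_n sqr_sqrtr ?ltW.
rewrite /normal_fun E2 mulrCA -expRD.
rewrite (_ : _ * (_ * _) = (Num.sqrt mu)^-1 * Num.sqrt mu * (normal_peak s *
  (expR (beta ^+ 2 / (2 * mu)) *
    expR (- (t - (m + s * beta / mu)) ^+ 2 / (s ^+ 2 / mu *+ 2))))); last by ring.
rewrite mulVf ?gt_eqF// mul1r -expRD; congr (_ * expR _).
by field; rewrite !gt_eqF.
Qed.

(** The integral is exactly [expR (c + beta^2 / (2 mu)) / sqrt mu]. Bounding [1 / sqrt mu] by
    [expR ((1 / mu - 1) / 2)] trades the determinant that would arise over several coordinates for a
    trace. *)
Lemma normal_quadratic_mgf m s mu beta c : 0 < s -> 0 < mu ->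
  (\int[normal_prob m s]_t (expR (c + (1 - mu) / 2 * ((t - m) / s) ^+ 2 +
     beta * ((t - m) / s)))%:E
   <= (expR (c + (mu^-1 - 1) / 2 + beta ^+ 2 / (2 * mu)))%:E)%E.
Proof.
move=> s0 mu0; rewrite integral_normal_prob; last 2 first.
- apply/measurable_EFinP/measurableT_comp => //.
  apply: measurable_funD; first apply: measurable_funD => //.
    apply: measurable_funM => //; apply: measurable_funX.
    by apply: measurable_funM => //; exact: measurable_funB.
  apply: measurable_funM => //.
  by apply: measurable_funM => //; exact: measurable_funB.
- by move=> t; rewrite lee_fin expR_ge0.
under eq_integral => t _.
  rewrite -EFinM -addrA expRD -(mulrA (expR c)) normal_pdf_tilt// mulrA EFinM; over.
rewrite ge0_integralZl//=; last 2 first.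
- by apply/measurable_EFinP; exact: measurable_normal_pdf.
- by move=> t _; rewrite lee_fin normal_pdf_ge0.
rewrite integral_normal_pdf mule1 lee_fin -!addrA !expRD mulrA.
rewrite -mulrA ler_wpM2l ?expR_ge0// ler_wpM2r ?expR_ge0//.
have q0 : 0 < Num.sqrt mu by rewrite sqrtr_gt0.
rewrite -(ler_pXn2r (n := 2))// ?nnegrE ?invr_ge0 ?expR_ge0 ?(ltW q0)//.
rewrite exprVn sqr_sqrtr ?(ltW mu0)// -expRM_natl mulr_natl.
have -> : (mu^-1 - 1) / 2 *+ 2 = mu^-1 - 1 by field; rewrite gt_eqF.
by have := @expR_ge1Dx _ (mu^-1 - 1); rewrite addrCA subrr addr0.
Qed.
End normal_integral.

(** * Inner products and the elimination of one coordinate *)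

Section inner_product.
Context {R : realType}.

Definition dot {n} (u v : 'cV[R]_n) : R := (u^T *m v) 0 0.

Definition posdef {n} (M : 'M[R]_n) := forall u : 'cV_n, u != 0 -> 0 < dot u (M *m u).

Lemma dotE n (u v : 'cV[R]_n) : dot u v = \sum_i u i 0 * v i 0.
Proof. by rewrite /dot mxE; apply: eq_bigr => i _; rewrite mxE. Qed.

Lemma dotC n (u v : 'cV[R]_n) : dot u v = dot v u.
Proof. by rewrite !dotE; apply: eq_bigr => i _; rewrite mulrC. Qed.

Lemma dotDr n (u v w : 'cV[R]_n) : dot u (v + w) = dot u v + dot u w.
Proof. by rewrite /dot mulmxDr mxE. Qed.

Lemma dotDl n (u v w : 'cV[R]_n) : dot (v + w) u = dot v u + dot w u.
Proof. by rewrite dotC dotDr !(dotC u). Qed.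

Lemma dotZr n a (u v : 'cV[R]_n) : dot u (a *: v) = a * dot u v.
Proof. by rewrite /dot -scalemxAr mxE. Qed.

Lemma dotZl n a (u v : 'cV[R]_n) : dot (a *: u) v = a * dot u v.
Proof. by rewrite dotC dotZr dotC. Qed.

Lemma dotNr n (u v : 'cV[R]_n) : dot u (- v) = - dot u v.
Proof. by rewrite -scaleN1r dotZr mulN1r. Qed.

Lemma dotNl n (u v : 'cV[R]_n) : dot (- u) v = - dot u v.
Proof. by rewrite dotC dotNr dotC. Qed.

Lemma dotBr n (u v w : 'cV[R]_n) : dot u (v - w) = dot u v - dot u w.
Proof. by rewrite dotDr dotNr. Qed.

Lemma dotBl n (u v w : 'cV[R]_n) : dot (v - w) u = dot v u - dot w u.
Proof. by rewrite dotDl dotNl. Qed.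

Lemma dot0r n (u : 'cV[R]_n) : dot u 0 = 0.
Proof. by rewrite /dot mulmx0 mxE. Qed.

Lemma dot_ge0 n (u : 'cV[R]_n) : 0 <= dot u u.
Proof. by rewrite dotE sumr_ge0// => i _; rewrite -expr2 sqr_ge0. Qed.

Lemma dot_gt0 n (u : 'cV[R]_n) : u != 0 -> 0 < dot u u.
Proof.
move=> u0; rewrite lt0r dot_ge0 andbT; apply: contra u0 => /eqP u0.
apply/eqP/matrixP => i j; rewrite ord1 mxE.
move: u0; rewrite dotE => /eqP; rewrite psumr_eq0; last by move=> k _; rewrite -expr2 sqr_ge0.
by move=> /allP /(_ i); rewrite mem_index_enum -expr2 sqrf_eq0 => /(_ isT)/eqP.
Qed.

Lemma dot_mulmxl m n (A : 'M[R]_(m, n)) (u : 'cV_n) (v : 'cV_m) :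
  dot (A *m u) v = dot u (A^T *m v).
Proof. by rewrite /dot trmx_mul mulmxA. Qed.

Lemma mul_outer n (a b u : 'cV[R]_n) : a *m b^T *m u = dot b u *: a.
Proof. by rewrite -mulmxA [b^T *m u]mx11_scalar mul_mx_scalar. Qed.

Lemma dot_col_mx m n (a b : 'cV[R]_m) (u v : 'cV[R]_n) :
  dot (col_mx a u) (col_mx b v) = dot a b + dot u v.
Proof. by rewrite /dot tr_col_mx mul_row_col mxE. Qed.

Lemma dot_scalar_mx (a b : R) : dot (a%:M : 'M[R]_1) b%:M = a * b.
Proof. by rewrite dotE big_ord1 !mxE eqxx !mulr1n. Qed.

Lemma inv_sym n (M V : 'M[R]_n) : M^T = M -> M *m V = 1%:M -> V^T = V.
Proof.
move=> symM MV; have VM : V^T *m M = 1%:M by rewrite -{1}symM -trmx_mul MV trmx1.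
by rewrite -[LHS]mulmx1 -MV mulmxA VM mul1mx.
Qed.

Lemma posdef_inv_ge0 n (M V : 'M[R]_n) (u : 'cV_n) :
  posdef M -> M *m V = 1%:M -> 0 <= dot u (V *m u).
Proof.
move=> pM MV; rewrite -{1}[u]mul1mx -MV -mulmxA.
have [->|v0] := eqVneq (V *m u) 0; first by rewrite mulmx0 dot0r.
by rewrite dotC ltW// pM.
Qed.

(* One step of Gaussian elimination on [M], followed through its inverse [V]. *)
Lemma schur_complement n (M V : 'M[R]_(1 + n)) (b : 'cV_(1 + n)) :
  M^T = M -> posdef M -> M *m V = 1%:M ->
  exists (mu beta : R) (a : 'cV[R]_n) (M1 M' V' : 'M[R]_n) (b1 b' : 'cV[R]_n),
  [/\ 0 < mu, M'^T = M', posdef M' & M' *m V' = 1%:M] /\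
  [/\ forall (t : R) (u : 'cV_n),
        dot (col_mx t%:M u) ((1%:M - M) *m col_mx t%:M u) / 2 + dot b (col_mx t%:M u)
        = (dot u ((1%:M - M1) *m u) / 2 + dot b1 u) + (1 - mu) / 2 * t ^+ 2
          + (beta - dot a u) * t,
      forall u : 'cV_n,
        (dot u ((1%:M - M1) *m u) / 2 + dot b1 u) + (beta - dot a u) ^+ 2 / (2 * mu)
        = beta ^+ 2 / (2 * mu) + dot u ((1%:M - M') *m u) / 2 + dot b' u
    & (mu^-1 - 1) / 2 + beta ^+ 2 / (2 * mu)
        + \tr (V' - 1%:M) / 2 + dot b' (V' *m b') / 2
      <= \tr (V - 1%:M) / 2 + dot b (V *m b) / 2].
Proof.
move=> symM pM MV; have symV := inv_sym symM MV.
pose mu := ulsubmx M 0 0; pose a := dlsubmx M; pose M1 := drsubmx M.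
have EM : M = block_mx mu%:M a^T a M1.
  rewrite -[LHS]submxK -mx11_scalar; congr block_mx.
  by rewrite /a -[in RHS]symM -trmx_ursub trmxK.
pose nu := ulsubmx V 0 0; pose e := dlsubmx V; pose V1 := drsubmx V.
have EV : V = block_mx nu%:M e^T e V1.
  rewrite -[LHS]submxK -mx11_scalar; congr block_mx.
  by rewrite /e -[in RHS]symV -trmx_ursub trmxK.
have symM1 : M1^T = M1 by rewrite /M1 trmx_drsub symM.
have symV1 : V1^T = V1 by rewrite /V1 trmx_drsub symV.
pose beta := usubmx b 0 0; pose b1 := dsubmx b.
have Eb : b = col_mx beta%:M b1 by rewrite -mx11_scalar vsubmxK.
have mulM t u : M *m col_mx t%:M u = col_mx (mu * t + dot a u)%:M (t *: a + M1 *m u).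
  rewrite EM mul_block_col -scalar_mxM mul_mx_scalar; congr col_mx.
  by rewrite raddfD /= [X in _ + X = _]mx11_scalar.
have mulV t u : V *m col_mx t%:M u = col_mx (nu * t + dot e u)%:M (t *: e + V1 *m u).
  rewrite EV mul_block_col -scalar_mxM mul_mx_scalar; congr col_mx.
  by rewrite raddfD /= [X in _ + X = _]mx11_scalar.
have mu0 : 0 < mu.
  have := pM (col_mx 1%:M 0); rewrite mulM dot_col_mx dot_scalar_mx dot0r addr0.
  rewrite (dotC 0) dot0r addr0 mul1r mulr1; apply; apply/eqP => /(congr1 usubmx).
  by rewrite col_mxKu raddf0 => /matrixP/(_ 0 0); rewrite !mxE => /eqP; rewrite oner_eq0.
have mun0 : mu != 0 by rewrite gt_eqF.
have := MV; rewrite {1}EM {1}EV mulmx_block [RHS](scalar_mx_block 1 n).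
case/eq_block_mx=> E1 E2 _ E4.
have eE : e = - mu^-1 *: (V1 *m a).
  have : mu *: e + V1 *m a = 0.
    move/(congr1 trmx): E2; rewrite raddfD /= trmx_mul trmx_mul !trmxK symV1 trmx0.
    by rewrite tr_scalar_mx mul_mx_scalar.
  move/eqP; rewrite addr_eq0 => /eqP E; rewrite scaleNr -scalerN -E.
  by rewrite scalerA mulVf// scale1r.
(* The corner of the inverse exceeds [1 / mu] by a nonnegative term, which is the slack in the final
   inequality. *)
have nuE : nu = mu^-1 + mu^-1 ^+ 2 * dot a (V1 *m a).
  move/matrixP: E1 => /(_ 0 0); rewrite -scalar_mxM 2!mxE -/(dot a e) mxE eE dotZr.
  rewrite !eqxx !mulr1n => E; apply: (mulfI mun0).
  rewrite mulrDr mulfV// -E; field; exact: mun0.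
pose M' := M1 - mu^-1 *: (a *m a^T).
have mulM' u : M' *m u = M1 *m u - (mu^-1 * dot a u) *: a.
  by rewrite mulmxBl -scalemxAl mul_outer scalerA.
have symM' : M'^T = M' by rewrite /M' !raddfB /= linearZ /= trmx_mul trmxK symM1.
have pM' : posdef M'.
  (* This [t] minimizes the form of [M] over its first coordinate, and the minimum is the form of
     the Schur complement [M']. *)
  move=> u u0; pose t := - (mu^-1 * dot a u).
  have := pM (col_mx t%:M u); rewrite mulM dot_col_mx dot_scalar_mx mulM'.
  rewrite dotDr dotZr dotBr dotZr (dotC u a) => H.
  suff -> : dot u (M1 *m u) - mu^-1 * dot a u * dot a u =
    t * (mu * t + dot a u) + (t * dot a u + dot u (M1 *m u)).
    apply: H; apply: contra u0 => /eqP/(congr1 dsubmx).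
    by rewrite col_mxKd raddf0 => ->.
  by rewrite /t; field; exact: mun0.
have MV' : M' *m V1 = 1%:M.
  rewrite /M' mulmxBl -E4 -[in RHS](trmxK e) -scalemxAl -mulmxA.
  rewrite -[X in _ - _ *: (_ *m X)]trmxK trmx_mul trmxK symV1.
  rewrite trmxK [RHS]addrC; congr (_ + _); rewrite eE.
  by rewrite [(_ *: _)^T]linearZ /= -scalemxAr scaleNr.
pose b' := b1 - (beta / mu) *: a.
exists mu, beta, a, M1, M', V1, b1, b'; split; first by split.
split.
- move=> t u; rewrite mulmxBl mul1mx mulM dotBr !dot_col_mx !dot_scalar_mx Eb.
  rewrite dot_col_mx dot_scalar_mx dotDr dotZr mulmxBl mul1mx dotBr (dotC u a).
  by field.
- move=> u; rewrite !mulmxBl !mul1mx -scalemxAl mul_outer !dotBr dotBl !dotZr dotZl (dotC u a).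
  by field; exact: mun0.
- have trE : \tr (V - 1%:M) = nu - 1 + \tr (V1 - 1%:M).
    rewrite !raddfB /= {1}EV (scalar_mx_block 1 n) !mxtrace_block !mxtrace_scalar.
    by rewrite mulr1n; ring.
  have pos := posdef_inv_ge0 a pM' MV'.
  rewrite trE Eb mulV dot_col_mx dot_scalar_mx eE !dotZl !dotDr !dotZr.
  rewrite /b' mulmxBr -scalemxAr !dotBl !dotBr !dotZl !dotZr.
  rewrite (dotC (V1 *m a) b1) (_ : dot a (V1 *m b1) = dot b1 (V1 *m a)); last first.
    by rewrite dotC dot_mulmxl symV1.
  rewrite -subr_ge0 [X in 0 <= X](_ : _ = mu^-1 ^+ 2 * dot a (V1 *m a) / 2); last first.
    by rewrite nuE; field; exact: mun0.
  by rewrite divr_ge0// mulr_ge0// sqr_ge0.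
Qed.
End inner_product.

(** * Gaussian vectors on product spaces *)

Section gaussian_space.
Context {R : realType}.

Lemma measurable_forall d (T : measurableType d) (I : finType) (B : I -> set T) :
  (forall i, measurable (B i)) -> measurable [set w | forall i, B i w].
Proof.
move=> mB; rewrite [X in measurable X](_ : _ = \bigcap_(i in [set: I]) B i).
  by apply: fin_bigcap_measurable => // i _; exact: mB.
by apply/seteqP; split=> w /= h i //; exact: h.
Qed.

Lemma measurable_dot d (T : measurableType d) n (f g : T -> 'cV[R]_n) :
  (forall i, measurable_fun setT (fun w => f w i 0)) ->
  (forall i, measurable_fun setT (fun w => g w i 0)) ->
  measurable_fun setT (fun w => dot (f w) (g w)).
Proof.
move=> mf mg; under eq_fun do rewrite dotE.
by apply: measurable_sum => i; exact: measurable_funM.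
Qed.

Lemma measurable_mulmx_col d (T : measurableType d) m n (A : 'M[R]_(m, n)) (f : T -> 'cV[R]_n) :
  (forall i, measurable_fun setT (fun w => f w i 0)) ->
  forall i, measurable_fun setT (fun w => (A *m f w) i 0).
Proof.
move=> mf i; under eq_fun do rewrite mxE.
by apply: measurable_sum => j; exact: measurable_funM.
Qed.

Definition standardize {T : Type} {n} (x : 'I_n -> R) (s : R) (c : 'I_n -> T -> R) (w : T) : 'cV_n :=
  \col_i ((c i w - x i) / s).

Lemma measurable_standardize d (T : measurableType d) n x s (c : 'I_n -> T -> R) :
  (forall i, measurable_fun setT (c i)) ->
  forall i, measurable_fun setT (fun w => standardize x s c w i 0).
Proof.
move=> mc i; under eq_fun do rewrite mxE.
by apply: measurable_funM => //; exact: measurable_funB.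
Qed.

Lemma measurable_expR_quadratic d (T : measurableType d) n (A : 'M[R]_n) b k (f : T -> 'cV[R]_n) :
  (forall i, measurable_fun setT (fun w => f w i 0)) ->
  measurable_fun setT (fun w => (expR (k + dot (f w) (A *m f w) / 2 + dot b (f w)))%:E).
Proof.
move=> mf; apply/measurable_EFinP/measurableT_comp => //.
apply: measurable_funD; last exact: measurable_dot.
apply: measurable_funD => //; apply: measurable_funM => //.
by apply: measurable_dot => //; exact: measurable_mulmx_col.
Qed.

(* Integrals are computed by Fubini's theorem on a product space, which is built
   one coordinate at a time; [probability_eq_boxes] transfers them to the model. *)
Lemma gaussian_vector n (x : 'I_n -> R) (s : R) : 0 < s ->
  exists d (T : measurableType d) (P : probability T R) (c : 'I_n -> T -> R),
  [/\ forall i, measurable_fun setT (c i),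
      forall A : 'I_n -> set R, (forall i, measurable (A i)) ->
        P [set w | forall i, A i (c i w)] = (\prod_i normal_prob (x i) s (A i))%E
    & forall (M V : 'M[R]_n) (b : 'cV[R]_n) k, M^T = M -> posdef M -> M *m V = 1%:M ->
        (\int[P]_w (expR (k + dot (standardize x s c w) ((1%:M - M) *m standardize x s c w) / 2
                            + dot b (standardize x s c w)))%:E
         <= (expR (k + \tr (V - 1%:M) / 2 + dot b (V *m b) / 2))%:E)%E].
Proof.
move=> s0; elim: n x => [|n IH] x.
  exists _, unit, (dirac tt), (fun _ _ => 0); split.
  - by [].
  - move=> A _; rewrite big_ord0 (_ : [set _ | _] = setT); first exact: probability_setT.
    by apply/seteqP; split => // w _ [].
  - move=> M V b k _ _ _; rewrite /dot !mxE !big_ord0 mul0r /mxtrace big_ord0 mul0r.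
    under eq_integral do rewrite !mxE !big_ord0 mul0r.
    by rewrite integral_cst//= diracE in_setT mule1.
pose l0 : 'I_n.+1 := lshift n (0 : 'I_1); pose x0 := x l0.
have [d [T [P [c [mc Pc mgf]]]]] := IH (fun i => x (rshift 1 i)).
pose N : probability (measurableTypeR R) R := normal_prob x0 s.
pose C (i : 'I_(1 + n)) (w : measurableTypeR R * T) :=
  match fintype.split i with inl _ => w.1 | inr j => c j w.2 end.
have mC i : measurable_fun setT (C i).
  rewrite /C; case: (fintype.split i) => [_|j]; first exact: measurable_fst.
  exact: (measurableT_comp (mc j) measurable_snd).
exists _, (measurableTypeR R * T)%type, (N \x P)%E, C; split => //.
- move=> A mA; rewrite (_ : [set _ | _] =
    A (l0) `*` [set w | forall i, A (rshift 1 i) (c i w)]); last first.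
    apply/seteqP; split => [w h|w [h0 h1] i]; rewrite /= ?/C.
      split=> [|i]; first by have := h (l0); rewrite /C (unsplitK (inl _)).
      by have := h (rshift 1 i); rewrite /C (unsplitK (inr _)).
    by case: fintype.splitP => j ij; [rewrite (_ : i = l0)|rewrite (_ : i = rshift 1 j)];
      rewrite //; apply/val_inj; rewrite /= ?ij ?ord1.
  rewrite [LHS]product_measure1E//; [|exact: mA|]; last first.
    by apply: measurable_forall => i; rewrite -[X in measurable X]setTI; exact: mc.
  rewrite [RHS](@big_split_ord _ _ _ 1 n)/= big_ord1; congr (_ * _)%E.
  exact: (Pc (fun i => A (rshift 1 i))).
- move=> M V b k symM pM MV.
  have [mu [beta [a [M1 [M' [V' [b1 [b' [[mu0 symM' pM' MV'] [E1 E2 E3]]]]]]]]]] :=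
    schur_complement b symM pM MV.
  pose z0 (t : R) := (t - x0) / s.
  pose z w := standardize (fun i => x (rshift 1 i)) s c w.
  have zE w : standardize x s C w = col_mx (z0 w.1)%:M (z w.2).
    apply/matrixP => i j; rewrite ord1 mxE /C; case: fintype.splitP => l il.
      have -> : i = l0 by apply/val_inj; rewrite /= il ord1.
      by rewrite [RHS]col_mxEu mxE eqxx mulr1n.
    have -> : i = rshift 1 l by exact/val_inj.
    by rewrite [RHS]col_mxEd mxE.
  (* The first coordinate is integrated with the others fixed. By [E1] its exponent is a
     one-variable quadratic, and by [E2] what remains is again the exponential of a quadratic form,
     with [M'] in place of [M]. The constant [k] collects the factors released on the way. *)
  rewrite fubini_tonelli2; last 2 first.
  + by apply: measurable_expR_quadratic; exact: measurable_standardize.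
  + by move=> w; rewrite lee_fin expR_ge0.
  apply: (@le_trans _ _ (\int[P]_w (expR (k + (mu^-1 - 1) / 2 + beta ^+ 2 / (2 * mu)
     + dot (z w) ((1%:M - M') *m z w) / 2 + dot b' (z w)))%:E)%E); last first.
    apply: (le_trans (mgf _ _ _ _ symM' pM' MV')).
    by rewrite lee_fin ler_expR -!addrA lerD2l !addrA.
  apply: ge0_le_integral => //.
  + by move=> w _; apply: integral_ge0 => t _; rewrite lee_fin expR_ge0.
  + apply: measurable_fun_fubini_tonelli_G.
      by apply: measurable_expR_quadratic; exact: measurable_standardize.
    by move=> w; rewrite lee_fin expR_ge0.
  + by apply: measurable_expR_quadratic; exact: measurable_standardize.
  + move=> w _; rewrite /fubini_G.
    under eq_integral => t _.
      rewrite zE/= -addrA E1 addrA addrA; over.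
    apply: (le_trans (normal_quadratic_mgf _ _ _ s0 mu0)).
    rewrite lee_fin ler_expR.
    have := E2 (z w); lra.
Qed.
End gaussian_space.

Section quadratic_forms.
Context {R : realType}.

(** Spectral norm at most one, expressed by the quadratic form so that differences of projections
    qualify without eigenvalues. *)
Definition contraction {n} (A : 'M[R]_n) :=
  A^T = A /\ forall u : 'cV_n, `|dot u (A *m u)| <= dot u u.

Lemma dot_cauchy n (u v : 'cV[R]_n) : dot u v ^+ 2 <= dot u u * dot v v.
Proof.
have [->|v0] := eqVneq v 0; first by rewrite !dot0r mulr0 expr0n.
have vv := dot_gt0 v0; set q := dot u v.
have := dot_ge0 (dot v v *: u - q *: v).
rewrite !(dotBl, dotBr, dotZl, dotZr) (dotC v u) -/q => H.
rewrite -(ler_pM2l vv); nra.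
Qed.

Lemma mxtrace_dot n (A B : 'M[R]_n) : \tr (A^T *m B) = \sum_i dot (col i A) (col i B).
Proof.
by apply: eq_bigr => i _; rewrite mxE dotE; apply: eq_bigr => j _; rewrite !mxE.
Qed.

(** As [l] is at most 1/4, the form of [M] is at least half the identity, so [M] is invertible and
    [V] is at most twice the identity. Using the resolvent identity twice gives
    [V - 1 = 2 l A + 4 l^2 A V A], and [\tr (A V A)] is at most [2 \tr (A A)], column by column. *)
Lemma resolvent n (A : 'M[R]_n) (l : R) : contraction A -> 0 <= l <= 1 / 4 ->
  let M := 1%:M - (2 * l) *: A in
  exists V, [/\ M^T = M, posdef M, M *m V = 1%:M,
    forall u, dot u (V *m u) <= 2 * dot u u &
    \tr (V - 1%:M) / 2 <= l * \tr A + 4 * l ^+ 2 * \tr (A *m A)].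
Proof.
move=> [symA cA] /andP[l0 l4] M.
have symM : M^T = M by rewrite /M raddfB /= trmx1 linearZ /= symA.
have geM u : dot u u / 2 <= dot u (M *m u).
  rewrite /M mulmxBl mul1mx -scalemxAl dotBr dotZr.
  have := cA u; have := dot_ge0 u; rewrite ler_norml => d0 /andP[_ c2]; nra.
have pM : posdef M.
  by move=> u u0; apply: lt_le_trans (geM u); rewrite divr_gt0// dot_gt0.
have uM : M \in unitmx.
  rewrite -row_free_unit -kermx_eq0; apply/eqP/row_matrixP => i; rewrite row0.
  apply/eqP; apply: contraT => v0; have := pM (row i (kermx M))^T.
  rewrite trmx_eq0 v0 => /(_ isT).
  by rewrite /dot trmxK mulmxA -row_mul mulmx_ker row0 mul0mx mxE ltxx.
pose V := invmx M; have MV : M *m V = 1%:M by rewrite mulmxV.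
have symV := inv_sym symM MV.
have leV u : dot u (V *m u) <= 2 * dot u u.
  have E : M *m (V *m u) = u by rewrite mulmxA MV mul1mx.
  have := geM (V *m u); rewrite E (dotC (V *m u)) => h1.
  have := dot_cauchy u (V *m u); have := dot_ge0 (V *m u); have := dot_ge0 u.
  set a := dot u u in h1 *; set b := dot (V *m u) _ in h1 *; set q := dot u _ in h1 *.
  move=> a0 b0 h2; rewrite leNgt; apply/negP => h3.
  have q0 : 0 < q by lra.
  have : q * q <= a * (2 * q) by rewrite -expr2 (le_trans h2)// ler_wpM2l//; lra.
  rewrite mulrCA (mulrC a) mulrA (mulrAC 2) => h4.
  have : q * q <= 2 * a * q by lra.
  by rewrite ler_pM2r// leNgt h3.
exists V; split => //.
have EV : V = 1%:M + (2 * l) *: (A *m V).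
  have := MV; rewrite /M mulmxBl mul1mx -scalemxAl => /eqP.
  by rewrite subr_eq => /eqP.
have EV' : V = 1%:M + (2 * l) *: (V *m A).
  by rewrite -{1}symV {1}EV raddfD /= trmx1 linearZ /= trmx_mul symA symV.
have -> : V - 1%:M = (2 * l) *: A + (4 * l ^+ 2) *: (A *m V *m A).
  have AV : A *m V = A + (2 * l) *: (A *m V *m A).
    by rewrite {1}EV' mulmxDr mulmx1 -scalemxAr mulmxA.
  rewrite {1}EV [LHS]addrC addKr {1}AV scalerDr scalerA; congr (_ + _ *: _).
  by ring.
rewrite mxtraceD !mxtraceZ.
suff : \tr (A *m V *m A) <= 2 * \tr (A *m A).
  have := sqr_ge0 l; set x := \tr (A *m V *m A); nra.
rewrite -{1 3}symA -mulmxA !mxtrace_dot mulr_sumr; apply: ler_sum => i _.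
by rewrite (_ : col i (V *m A) = V *m col i A) ?leV// !colE mulmxA.
Qed.

(** Bounds the logarithm of the Laplace transform at [l] of [y^T A y / s^2], for [y] Gaussian with
    mean [x] and covariance [s^2 I]. The terms linear in [l] are the exact mean, the others a
    variance proxy. *)
Definition quad_bound {n} (A : 'M[R]_n) (x : 'cV_n) (s l : R) : R :=
  l * dot x (A *m x) / s ^+ 2 + l * \tr A
  + 4 * l ^+ 2 * (\tr (A *m A) + dot (A *m x) (A *m x) / s ^+ 2).

Definition colf {T : Type} {n} (c : 'I_n -> T -> R) (w : T) : 'cV[R]_n := \col_i c i w.

Lemma gaussian_vector_quadratic n (x : 'cV[R]_n) (s : R) : 0 < s ->
  exists d (T : measurableType d) (P : probability T R) (c : 'I_n -> T -> R),
  [/\ forall i, measurable_fun setT (c i),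
      forall A : 'I_n -> set R, (forall i, measurable (A i)) ->
        P [set w | forall i, A i (c i w)] = (\prod_i normal_prob (x i 0%R) s (A i))%E
    & forall (A : 'M[R]_n) l, contraction A -> 0 <= l <= 1 / 4 ->
        (\int[P]_w (expR (l * dot (colf c w) (A *m colf c w) / s ^+ 2))%:E
          <= (expR (quad_bound A x s l))%:E)%E].
Proof.
move=> s0; have [d [T [P [c [mc Pc mgf]]]]] := gaussian_vector (fun i => x i 0) s0.
exists d, T, P, c; split => // A l cA l4; pose y := colf c.
have [V [symM pM MV leV trV]] := resolvent cA l4.
have sn0 : s != 0 by rewrite gt_eqF.
pose z w := standardize (fun i => x i 0) s c w.
have yE w : y w = x + s *: z w.
  by apply/matrixP => i j; rewrite ord1 !mxE; field.
(* In terms of the standardized noise the mean contributes the constant [k] and the linear term [b].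
   Since [V] is at most twice the identity, [dot b (V *m b) / 2] is at most [dot b b], the last term
   of [quad_bound]. *)
pose b := (2 * l / s) *: (A *m x); pose k := l * dot x (A *m x) / s ^+ 2.
have E w : l * dot (y w) (A *m y w) / s ^+ 2 =
    k + dot (z w) ((1%:M - (1%:M - (2 * l) *: A)) *m z w) / 2 + dot b (z w).
  rewrite yE mulmxDr -scalemxAr !dotDl !dotDr !dotZl !dotZr.
  rewrite (_ : dot x (A *m z w) = dot (A *m x) (z w)); last first.
    by rewrite dot_mulmxl cA.1.
  rewrite (dotC (z w) (A *m x)) (_ : 1%:M - (1%:M - (2 * l) *: A) = (2 * l) *: A); last first.
    by rewrite opprB addrC subrK.
  rewrite -scalemxAl dotZr /k.
  by field.
under eq_integral => w _ do rewrite -/(y w) E.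
apply: (le_trans (mgf _ _ b k symM pM MV)); rewrite lee_fin ler_expR.
have h := leV b; rewrite /quad_bound -/k.
set q := dot (A *m x) (A *m x).
have hb : dot b b = 4 * l ^+ 2 * (q / s ^+ 2).
  by rewrite /b dotZl dotZr -/q; field.
rewrite hb in h; rewrite mulrDr; move: trV h.
set t1 := \tr _; set t2 := l * _; set t3 := _ * \tr _; set t4 := _ * (q / _).
lra.
Qed.

(** Independent columns make the exponents add up. Each column carries its own matrix, so zero
    matrices restrict the form to a subset of the columns. *)
Lemma gaussian_matrix_quadratic n p (X : 'M[R]_(n, p)) (s : R) : 0 < s ->
  exists d (T : measurableType d) (P : probability T R) (c : 'I_p -> 'I_n -> T -> R),
  [/\ forall j i, measurable_fun setT (c j i),
      forall A : 'I_p -> 'I_n -> set R, (forall j i, measurable (A j i)) ->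
        P [set w | forall j i, A j i (c j i w)] =
        (\prod_j \prod_i normal_prob (X i j) s (A j i))%E
    & forall (A : 'I_p -> 'M[R]_n) l, (forall j, contraction (A j)) -> 0 <= l <= 1 / 4 ->
        (\int[P]_w (expR (\sum_j l * dot (colf (c j) w) (A j *m colf (c j) w) / s ^+ 2))%:E
          <= (expR (\sum_j quad_bound (A j) (col j X) s l))%:E)%E].
Proof.
move=> s0; elim: p X => [|p IH] X.
  exists _, unit, (dirac tt), (fun _ _ _ => 0); split.
  - by [].
  - move=> A _; rewrite big_ord0 (_ : [set _ | _] = setT); first exact: probability_setT.
    by apply/seteqP; split => // w _ [].
  - move=> A l _ _; rewrite big_ord0; under eq_integral do rewrite big_ord0.
    by rewrite integral_cst//= diracE in_setT mule1.
have [d [T [P [c [mc Pc mgf]]]]] := IH (colsub (lift ord0) X).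
have [d0 [T0 [P0 [c0 [mc0 Pc0 mgf0]]]]] := gaussian_vector_quadratic (col ord0 X) s0.
pose C (j : 'I_p.+1) i (w : T0 * T) :=
  match unlift ord0 j with None => c0 i w.1 | Some j' => c j' i w.2 end.
have C0 i w : C ord0 i w = c0 i w.1 by rewrite /C unlift_none.
have C1 j i w : C (lift ord0 j) i w = c j i w.2 by rewrite /C liftK.
have mC j i : measurable_fun setT (C j i).
  rewrite /C; case: (unlift ord0 j) => [k|].
    exact: (measurableT_comp (mc k i) measurable_snd).
  exact: (measurableT_comp (mc0 i) measurable_fst).
exists _, (T0 * T)%type, (P0 \x P)%E, C; split => //.
- move=> A mA; rewrite (_ : [set _ | _] =
    [set w | forall i, A ord0 i (c0 i w)] `*`
    [set w | forall j i, A (lift ord0 j) i (c j i w)]); last first.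
    apply/seteqP; split => [w h|w [h0 h1] j i] /=.
      by split=> [i|j i]; [rewrite -C0|rewrite -C1]; exact: h.
    by case: (unliftP ord0 j) => [k|] ->; rewrite ?C0 ?C1.
  rewrite [LHS]product_measure1E//; first last.
  + apply: measurable_forall => j; apply: measurable_forall => i.
    by rewrite -[X in measurable X]setTI; exact: mc.
  + by apply: measurable_forall => i; rewrite -[X in measurable X]setTI; exact: mc0.
  rewrite [RHS]big_ord_recl; congr (_ * _)%E.
    by apply: etrans (Pc0 (A ord0) _) _ => //; apply: eq_bigr => i _; rewrite mxE.
  apply: etrans (Pc (fun j => A (lift ord0 j)) _) _ => //.
  by apply: eq_bigr => j _; apply: eq_bigr => i _; rewrite mxE.
- move=> A l cA l4; pose y0 := colf c0; pose y1 w j := colf (c j) w.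
  have yE0 w : colf (C ord0) w = y0 w.1 by apply/matrixP => i k; rewrite !mxE C0.
  have yE1 w j : colf (C (lift ord0 j)) w = y1 w.2 j by apply/matrixP => i k; rewrite !mxE C1.
  have mq (d' : measure_display) (T' : measurableType d') (f : T' -> 'cV[R]_n) j :
      (forall i, measurable_fun setT (fun w => f w i 0)) ->
      measurable_fun setT (fun w => l * dot (f w) (A j *m f w) / s ^+ 2).
    move=> mf; apply: measurable_funM => //; apply: measurable_funM => //.
    by apply: measurable_dot => //; exact: measurable_mulmx_col.
  rewrite fubini_tonelli2; last 2 first.
  + apply/measurable_EFinP/measurableT_comp => //; apply: measurable_sum => j.
    by apply: mq => i; under eq_fun do rewrite mxE; exact: mC.
  + by move=> w; rewrite lee_fin expR_ge0.
  have mT : measurable_fun setT (fun w : T =>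
      (expR (\sum_j l * dot (y1 w j) (A (lift ord0 j) *m y1 w j) / s ^+ 2))%:E).
    apply/measurable_EFinP/measurableT_comp => //; apply: measurable_sum => j.
    by apply: mq => i; under eq_fun do rewrite mxE; exact: mc.
  have mT0 : measurable_fun setT (fun w : T0 =>
      (expR (l * dot (y0 w) (A ord0 *m y0 w) / s ^+ 2))%:E).
    apply/measurable_EFinP/measurableT_comp => //.
    by apply: mq => i; under eq_fun do rewrite mxE; exact: mc0.
  rewrite /fubini_G; under eq_integral => w _.
    under eq_integral => t _.
      rewrite big_ord_recl yE0 /= expRD EFinM.
      under eq_bigr do rewrite yE1 /=.
      over.
    rewrite ge0_integralZr//=; over.
  rewrite /= ge0_integralZl//; last by apply: integral_ge0 => w _; rewrite lee_fin expR_ge0.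
  rewrite big_ord_recl expRD EFinM; apply: lee_pmul.
  + by apply: integral_ge0 => w _; rewrite lee_fin expR_ge0.
  + by apply: integral_ge0 => w _; rewrite lee_fin expR_ge0.
  + exact: mgf0.
  + have := mgf (fun j => A (lift ord0 j)) l (fun j => cA _) l4 => /le_trans; apply.
    rewrite lee_fin ler_expR; apply: ler_sum => j _.
    by rewrite (_ : col j _ = col (lift ord0 j) X)//; apply/matrixP => a b; rewrite !mxE.
Qed.
End quadratic_forms.

(** * Transfer to the data of the model *)

Section gaussian_model.
Context {R : realType}.

Lemma probability_eq_boxes n p (P1 P2 : probability (n.-tuple (p.-tuple R)) R) :
  (forall A : 'I_n -> 'I_p -> set R, (forall i j, measurable (A i j)) ->
    P1 [set y | forall i j, A i j (tnth (tnth y i) j)] =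
    P2 [set y | forall i j, A i j (tnth (tnth y i) j)]) ->
  forall B, measurable B -> P1 B = P2 B.
Proof.
move=> eqP12.
pose T : measurableType _ := n.-tuple (p.-tuple R).
pose box (A : 'I_n -> 'I_p -> set R) : set T := [set y | forall i j, A i j (tnth (tnth y i) j)].
pose G : set (set T) := [set B | exists2 A, (forall i j, measurable (A i j)) & B = box A].
have GT : G setT.
  by exists (fun _ _ => setT) => //; apply/seteqP; split.
have mbox A : (forall i j, measurable (A i j)) -> measurable (box A).
  move=> mA; apply: measurable_forall => i; apply: measurable_forall => j.
  rewrite -[X in measurable X]setTI.
  exact: (measurableT_comp (measurable_tnth j) (measurable_tnth i)).
have mG : @measurable _ T = <<s G >>.
  apply/seteqP; split; last first.
    apply: smallest_sub; first exact: sigma_algebra_measurable.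
    by move=> _ [A mA ->]; exact: mbox.
  (* The identity, read from the sigma-algebra generated by the boxes: it is measurable as soon as
     its coordinates are, because these generate the sigma-algebra of the tuples. *)
  pose f (x : g_sigma_algebraType G) : T := x.
  suff mf : measurable_fun setT f by move=> B mB; have := mf measurableT B mB; rewrite setTI.
  apply/measurable_fun_tnthP => i; apply/measurable_fun_tnthP => j.
  move=> _ A mA; rewrite setTI; apply: sub_sigma_algebra.
  exists (fun i' j' => if (i' == i) && (j' == j) then A else setT).
    by move=> i' j'; case: ifP.
  apply/seteqP; split=> y /=.
    by move=> Ay i' j'; case: ifP => // /andP[/eqP -> /eqP ->].
  by move=> /(_ i j); rewrite !eqxx.
move=> B mB; apply: (measure_unique G (fun=> setT)) => //.
- move=> _ _ [A mA ->] [A' mA' ->]; exists (fun i j => A i j `&` A' i j).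
    by move=> i j; exact: measurableI.
  apply/seteqP; split=> y /=.
    by move=> [h h'] i j; split.
  by move=> h; split=> i j; have [] := h i j.
- by rewrite bigcup_const.
- by move=> _ [A mA ->]; exact: eqP12.
- by move=> k; rewrite -ge0_fin_numE// fin_num_measure.
Qed.

Definition data_col {n p} (y : n.-tuple (p.-tuple R)) (j : 'I_p) : 'cV[R]_n :=
  \col_i tnth (tnth y i) j.

Lemma measurable_data_col n p j i :
  measurable_fun setT (fun y : n.-tuple (p.-tuple R) => data_col y j i 0).
Proof.
under eq_fun do rewrite mxE.
exact: (measurableT_comp (measurable_tnth j) (measurable_tnth i)).
Qed.

Lemma measurable_data_quadratic n p j (A : 'M[R]_n) :
  measurable_fun setT (fun y : n.-tuple (p.-tuple R) => dot (data_col y j) (A *m data_col y j)).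
Proof.
by apply: measurable_dot => [|i]; [|apply: measurable_mulmx_col]; exact: measurable_data_col.
Qed.

Definition gaussian_data {d} {Omega : measurableType d} (P : probability Omega R) {n p}
    (Y : Omega -> n.-tuple (p.-tuple R)) (X : 'M[R]_(n, p)) (s : R) :=
  forall A : 'I_n -> 'I_p -> set R, (forall i j, measurable (A i j)) ->
    P [set w | forall i j, A i j (tnth (tnth (Y w) i) j)] =
    (\prod_i \prod_j normal_prob (X i j) s (A i j))%E.

Lemma gaussian_data_quadratic_mgf d (Omega : measurableType d) (P : probability Omega R) n p
    (Y : {RV P >-> n.-tuple (p.-tuple R)}) X s (A : 'I_p -> 'M[R]_n) l :
  0 < s -> gaussian_data P Y X s -> (forall j, contraction (A j)) -> 0 <= l <= 1 / 4 ->
  (\int[P]_w (expR (\sum_j l * dot (data_col (Y w) j) (A j *m data_col (Y w) j) / s ^+ 2))%:E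
    <= (expR (\sum_j quad_bound (A j) (col j X) s l))%:E)%E.
Proof.
move=> s0 gY cA l4.
have [d' [T' [P' [c [mc Pc mgf]]]]] := gaussian_matrix_quadratic X s0.
pose Z (w : T') : n.-tuple (p.-tuple R) := [tuple [tuple c j i w | j < p] | i < n].
have mZ : measurable_fun setT Z.
  apply/measurable_fun_tnthP => i; apply/measurable_fun_tnthP => j.
  by rewrite (_ : _ \o _ = c j i)//; apply/funext => w /=; rewrite !tnth_mktuple.
pose ZRV : {RV P' >-> n.-tuple (p.-tuple R)} := HB.pack Z (isMeasurableFun.Build _ _ _ _ _ mZ).
have eqd : forall B, measurable B -> distribution P Y B = distribution P' ZRV B.
  apply: probability_eq_boxes => B mB.
  rewrite /distribution /pushforward /=; apply: etrans (gY _ mB) _.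
  rewrite exchange_big /=; apply: etrans (esym (Pc (fun j i => B i j) _)) _ => //.
  congr (P' _); apply/seteqP; split => w /= h i j; have := h j i; rewrite !tnth_mktuple//.
pose F (y : n.-tuple (p.-tuple R)) :=
  (expR (\sum_j l * dot (data_col y j) (A j *m data_col y j) / s ^+ 2))%:E.
have mF : measurable_fun setT F.
  apply/measurable_EFinP/measurableT_comp => //; apply: measurable_sum => j.
  by apply: measurable_funM => //; apply: measurable_funM => //; exact: measurable_data_quadratic.
have F0 y : (0 <= F y)%E by rewrite lee_fin expR_ge0.
have -> : (\int[P]_w (F (Y w)) = \int[P']_w F (Z w))%E.
  apply: etrans (esym (ge0_integral_distribution Y mF F0)) _.
  apply: etrans _ (ge0_integral_distribution ZRV mF F0).
  by apply: eq_measure_integral => B mB _; exact: eqd.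
apply: le_trans (mgf A l cA l4); apply: ge0_le_integral => //.
- exact: (measurableT_comp mF mZ).
- apply/measurable_EFinP/measurableT_comp => //; apply: measurable_sum => j.
  apply: measurable_funM => //; apply: measurable_funM => //.
  by apply: measurable_dot => [|i]; [|apply: measurable_mulmx_col] => i';
    under eq_fun do rewrite mxE; exact: mc.
- move=> w _; rewrite lee_fin ler_expR; apply: ler_sum => j _.
  rewrite (_ : data_col (Z w) j = colf (c j) w)//.
  by apply/matrixP => i k; rewrite !mxE !tnth_mktuple.
Qed.

(** Markov's inequality for the exponential of the form. The sign of the matrices is free, so lower
    tails follow by negation. *)
Lemma gaussian_quadratic_tail d (Omega : measurableType d) (P : probability Omega R) n p
    (Y : {RV P >-> n.-tuple (p.-tuple R)}) X s (A : 'I_p -> 'M[R]_n) (l t : R) :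
  0 < s -> gaussian_data P Y X s -> (forall j, contraction (A j)) -> 0 <= l <= 1 / 4 ->
  (P [set w | (t * s ^+ 2 <= \sum_j dot (data_col (Y w) j) (A j *m data_col (Y w) j))%R]
    <= (expR (\sum_j quad_bound (A j) (col j X) s l - l * t))%:E)%E.
Proof.
move=> s0 gY cA l4; have mgf := gaussian_data_quadratic_mgf s0 gY cA l4.
set S := [set w | _].
pose Q w := \sum_j dot (data_col (Y w) j) (A j *m data_col (Y w) j).
have mQ : measurable_fun setT Q.
  apply: measurable_sum => j.
  exact: (measurableT_comp (measurable_data_quadratic j (A j)) (measurable_funPT Y)).
have mS : measurable S.
  rewrite (_ : S = Q @^-1` `[t * s ^+ 2, +oo[).
    by rewrite -[X in measurable X]setTI; exact: mQ.
  by apply/seteqP; split => w; rewrite /S /Q /= in_itv /= andbT.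
have s2 : 0 < s ^+ 2 by rewrite exprn_gt0.
rewrite expRD EFinM -(muleC (expR (- _))%:E).
apply: le_trans (lee_wpmul2l _ mgf); last by rewrite lee_fin expR_ge0.
have mE : measurable_fun setT (fun w => (expR
    (\sum_j l * dot (data_col (Y w) j) (A j *m data_col (Y w) j) / s ^+ 2))%:E).
  apply/measurable_EFinP/measurableT_comp => //; apply: measurable_sum => j.
  apply: measurable_funM => //; apply: measurable_funM => //.
  exact: (measurableT_comp (measurable_data_quadratic j (A j)) (measurable_funPT Y)).
rewrite -ge0_integralZl//.
rewrite -[X in P X](setIT S) -integral_indic//; apply: ge0_le_integral => //.
- by apply/measurable_EFinP; exact: measurable_indic.
- by apply: emeasurable_funM => //; exact: measurable_cst.
- move=> w _; rewrite -EFinM lee_fin -expRD indicE.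
  case: (boolP (w \in S)) => [|_]; last by rewrite expR_ge0.
  rewrite inE /S /= -/(Q w) => tQ.
  rewrite -[leLHS]expR0 ler_expR addrC subr_ge0 -mulr_suml -mulr_sumr -mulrA.
  by rewrite ler_wpM2l ?(andP l4).1// ler_pdivlMr.
Qed.
End gaussian_model.

(** * Labellings and their projections *)

Section projections.
Context {R : realType} {n K : nat}.
Implicit Types g h : 'I_n -> 'I_K.

Definition fiber (g : 'I_n -> 'I_K) (k : 'I_K) : {set 'I_n} := [set i | g i == k]%SET.

Definition fsize g k : R := #|fiber g k|%:R.

Lemma fsizeE g k : fsize g k = \sum_i (g i == k)%:R.
Proof.
rewrite /fsize /fiber -sum1_card natr_sum big_mkcond/=.
by apply: eq_bigr => i _; rewrite inE; case: ifP.
Qed.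

Lemma fsize_gt0 g i : 0 < fsize g (g i).
Proof. by rewrite ltr0n; apply/card_gt0P; exists i; rewrite inE. Qed.

Lemma fsize_neq0 g i : fsize g (g i) != 0.
Proof. by rewrite gt_eqF ?fsize_gt0. Qed.

Definition projm g : 'M[R]_n := \matrix_(i, i') ((g i == g i')%:R / fsize g (g i)).

Lemma projm_sym g : (projm g)^T = projm g.
Proof.
by apply/matrixP => i j; rewrite !mxE eq_sym; case: eqP => [->|_]//; rewrite !mul0r.
Qed.

Lemma projm_row_sum g i : \sum_j projm g i j = 1.
Proof.
under eq_bigr do rewrite mxE eq_sym.
by rewrite -mulr_suml -fsizeE divff ?fsize_neq0.
Qed.

Lemma projm_fixed g (x : 'cV[R]_n) (f : 'I_K -> R) :
  (forall i, x i 0 = f (g i)) -> projm g *m x = x.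
Proof.
move=> xE; apply/matrixP => i j; rewrite ord1 mxE xE -[RHS]mul1r -(projm_row_sum g i) mulr_suml.
apply: eq_bigr => l _; rewrite xE mxE; case: eqP => [->//|_].
by rewrite !mul0r.
Qed.

Lemma projm_idem g : projm g *m projm g = projm g.
Proof.
apply/matrixP => i j; rewrite mxE mxE.
transitivity (\sum_l projm g i l * ((g i == g j)%:R / fsize g (g i))).
  apply: eq_bigr => l _; rewrite !mxE; case: eqP => [->//|_].
  by rewrite !mul0r.
by rewrite -mulr_suml projm_row_sum mul1r.
Qed.

Lemma sum_inv_fsize g : (forall k, exists i, g i = k) -> \sum_i (fsize g (g i))^-1 = K%:R.
Proof.
move=> surj; rewrite (partition_big g xpredT)//=.
rewrite (eq_bigr (fun=> 1)); first by rewrite sumr_const card_ord.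
move=> k _; have [i0 gi0] := surj k.
rewrite (eq_bigr (fun=> (fsize g k)^-1)); last by move=> i /eqP ->.
rewrite sumr_const -mulr_natl -[X in X%:R * _]cardsE -/(fiber g k) -/(fsize g k) divff//.
by rewrite -gi0 fsize_neq0.
Qed.

Lemma projm_trace g : (forall k, exists i, g i = k) -> \tr (projm g) = K%:R.
Proof.
move=> surj; rewrite -(sum_inv_fsize surj); apply: eq_bigr => i _.
by rewrite mxE eqxx mul1r.
Qed.
End projections.

Section symmetric_idempotents.
Context {R : realType} {n : nat}.
Implicit Types P Q : 'M[R]_n.

Definition sym_idem P := P^T = P /\ P *m P = P.

Lemma sym_idem1 : sym_idem (1%:M : 'M[R]_n).
Proof. by split; rewrite ?trmx1 ?mulmx1. Qed.

Lemma sym_idem_normE P (u : 'cV_n) : sym_idem P -> dot (P *m u) (P *m u) = dot u (P *m u).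
Proof. by move=> [sP iP]; rewrite dot_mulmxl sP mulmxA iP. Qed.

Lemma sym_idem_ge0 P (u : 'cV_n) : sym_idem P -> 0 <= dot u (P *m u).
Proof. by move=> sP; rewrite -sym_idem_normE// dot_ge0. Qed.

Lemma sym_idem_le P (u : 'cV_n) : sym_idem P -> dot u (P *m u) <= dot u u.
Proof.
move=> sP; have := dot_ge0 (u - P *m u).
rewrite dotBl !dotBr sym_idem_normE// (dotC (P *m u) u); lra.
Qed.

(** Both quadratic forms lie between 0 and [dot u u]. *)
Lemma contraction_sub P Q : sym_idem P -> sym_idem Q -> contraction (P - Q).
Proof.
move=> sP sQ; split; first by rewrite raddfB /= sP.1 sQ.1.
move=> u; rewrite mulmxBl dotBr ler_norml.
have := sym_idem_ge0 u sP; have := sym_idem_le u sP.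
have := sym_idem_ge0 u sQ; have := sym_idem_le u sQ.
by move=> *; apply/andP; split; lra.
Qed.

Lemma sym_idem0 : sym_idem (0 : 'M[R]_n).
Proof. by split; rewrite ?trmx0 ?mulmx0. Qed.

Lemma contraction0 : contraction (0 : 'M[R]_n).
Proof. by rewrite -(subrr 0); apply: contraction_sub; exact: sym_idem0. Qed.

Lemma contraction_idem P : sym_idem P -> contraction P.
Proof. by move=> sP; rewrite -(subr0 P); apply: contraction_sub => //; exact: sym_idem0. Qed.

Lemma contractionN_idem P : sym_idem P -> contraction (- P).
Proof. by move=> sP; rewrite -(sub0r P); apply: contraction_sub => //; exact: sym_idem0. Qed.

Lemma quad_bound0 (x : 'cV[R]_n) s l : quad_bound 0 x s l = 0.
Proof. by rewrite /quad_bound !mul0mx !dot0r mxtrace0 !(mulr0, mul0r, addr0). Qed.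
End symmetric_idempotents.

(** * Distance between the projections of two labellings *)

Section labellings.
Context {R : realType} {n K : nat}.
Implicit Types g h : 'I_n -> 'I_K.

Lemma sym_idem_projm g : sym_idem (projm g : 'M[R]_n).
Proof. by split; [exact: projm_sym|exact: projm_idem]. Qed.

Definition hamming g h : nat := #|[set i | g i != h i]%SET|.

Lemma sum_fiber_hamming g h :
  \sum_k #|(fiber g k :\: fiber h k)%SET| = hamming g h.
Proof.
rewrite /hamming -sum1_card (partition_big g xpredT)//=.
apply: eq_bigr => k _; rewrite -sum1_card; apply: eq_bigl => i.
by rewrite !inE andbC eq_sym; case: eqP => [->|]; rewrite ?andbT ?andbF// eq_sym.
Qed.

Lemma hammingC g h : hamming g h = hamming h g.
Proof. by apply: eq_card => i; rewrite !inE eq_sym. Qed.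

(** The trace is a sum over all pairs of labels of squared overlaps divided by products of sizes.
    Keeping the pairs of equal labels suffices when the labels of [g] are matched to those of
    [h]. *)
Lemma projm_trace_mul_ge g h :
  \sum_k #|(fiber g k :&: fiber h k)%SET|%:R ^+ 2 / (fsize g k * fsize h k)
    <= \tr (projm g *m projm h) :> R.
Proof.
pose e i k : R := (i \in (fiber g k :&: fiber h k)%SET)%:R.
have eE i k : e i k = ((g i == k) && (h i == k))%:R by rewrite /e !inE.
have -> : \tr (projm g *m projm h) = \sum_i \sum_j projm g i j * projm h i j :> R.
  apply: eq_bigr => i _; rewrite mxE; apply: eq_bigr => j _.
  by rewrite -[in LHS](projm_sym h) [X in _ * X]mxE.
rewrite [leLHS](_ : _ = \sum_i \sum_j \sum_k e i k * e j k / (fsize g k * fsize h k)); last first.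
  rewrite [RHS](eq_bigr (fun i => \sum_k \sum_j e i k * e j k / (fsize g k * fsize h k))); last first.
    by move=> i _; rewrite exchange_big.
  rewrite exchange_big /=; apply: eq_bigr => k _.
  have -> : #|(fiber g k :&: fiber h k)%SET|%:R = \sum_i e i k.
    by rewrite -sum1_card natr_sum big_mkcond/=; apply: eq_bigr => i _; rewrite /e; case: ifP.
  rewrite expr2 -mulrA mulr_suml; apply: eq_bigr => i _.
  rewrite mulr_suml mulr_sumr; apply: eq_bigr => j _; by rewrite mulrA.
apply: ler_sum => i _; apply: ler_sum => j _.
rewrite (bigD1 (g i))//= [X in _ + X]big1 ?addr0; last first.
  by move=> k /negbTE kg; rewrite eE (eq_sym (g i)) kg /= !mul0r.
have pos : 0 <= (projm g i j * projm h i j : R).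
  by rewrite !mxE !mulr_ge0 ?invr_ge0 ?ler0n ?ltW ?fsize_gt0.
rewrite !eE eqxx /=; case: (eqVneq (h i) (g i)) => [hg|_]; last by rewrite !mul0r.
case: (eqVneq (g j) (g i)) => [gj|_]; last by rewrite mulr0 mul0r.
case: (eqVneq (h j) (g i)) => [hj|_]; last by rewrite mulr0 mul0r.
by rewrite !mxE gj hj hg !eqxx !mul1r invfM.
Qed.

(** Here [x] stands for the overlap of two blocks with the same label, [u] and [v] for their
    differences. Only [x + v], the size of the true block, may appear in the denominator: candidate
    blocks can be tiny. *)
Lemma overlap_defect (x u v : R) : 0 <= x -> 0 <= u -> 0 <= v -> 0 < x + u -> 0 < x + v ->
  1 - x ^+ 2 / ((x + u) * (x + v)) <= 3 * (u + v) / (x + v).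
Proof.
move=> x0 u0 v0 xu xv; rewrite -subr_ge0.
have -> : 3 * (u + v) / (x + v) - (1 - x ^+ 2 / ((x + u) * (x + v))) =
  (3 * (u + v) * (x + u) - (x + u) * (x + v) + x ^+ 2) / ((x + u) * (x + v)).
  by field; rewrite !gt_eqF.
apply: divr_ge0; last by rewrite mulr_ge0 ?ltW.
rewrite (_ : _ + x ^+ 2 = 2 * (u * x) + 3 * u ^+ 2 + 2 * (v * x) + 2 * (u * v)); last by ring.
by rewrite !addr_ge0 ?mulr_ge0 ?sqr_ge0.
Qed.

(** The squared Frobenius norm is [2 K - 2 \tr (P_g P_h)]. Each label contributes a defect bounded
    by [overlap_defect], and a misplaced point is counted once in a block of [g] and once in a block
    of [h]: the constant is [2 * 3 * 2]. *)
Lemma projm_sub_frobenius g h (b : R) :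
  (forall k, exists i, g i = k) -> (forall k, exists i, h i = k) ->
  0 < b -> (forall k, b <= fsize h k) ->
  \tr ((projm g - projm h) *m (projm g - projm h)) <= 12 * (hamming g h)%:R / b.
Proof.
move=> sg sh b0 bh.
have [_ ig] := sym_idem_projm g; have [_ ih] := sym_idem_projm h.
rewrite mulmxBl !mulmxBr ig ih !raddfB /= (mxtrace_mulC (projm h)) !projm_trace//.
have H := projm_trace_mul_ge g h.
suff : \sum_(k < K) (1 - #|(fiber g k :&: fiber h k)%SET|%:R ^+ 2 / (fsize g k * fsize h k))
    <= 6 * (hamming g h)%:R / b.
  rewrite sumrB sumr_const card_ord => H'.
  rewrite (_ : 12 * _ / b = 2 * (6 * (hamming g h)%:R / b)); last by ring.
  move: H H'; set c := \sum_k _; set m := 6 * _ / b; set t := \tr _; lra.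
have -> : 6 * (hamming g h)%:R / b = \sum_(k < K) 3 *
    (#|(fiber g k :\: fiber h k)%SET|%:R + #|(fiber h k :\: fiber g k)%SET|%:R) / b.
  rewrite -mulr_suml -mulr_sumr big_split /= -!natr_sum !sum_fiber_hamming (hammingC h g).
  by ring.
apply: ler_sum => k _.
have eg : fsize g k = (#|(fiber g k :&: fiber h k)%SET|%:R + #|(fiber g k :\: fiber h k)%SET|%:R : R).
  by rewrite -natrD cardsID.
have eh : fsize h k = (#|(fiber g k :&: fiber h k)%SET|%:R + #|(fiber h k :\: fiber g k)%SET|%:R : R).
  by rewrite -natrD finset.setIC cardsID.
have [i gi] := sg k; have [j hj] := sh k.
have g0 : 0 < fsize g k :> R by rewrite -gi fsize_gt0.
have h0 : 0 < fsize h k :> R by rewrite -hj fsize_gt0.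
have hb := bh k.
move: g0 h0 hb; rewrite eg eh => g0 h0 hb.
apply: le_trans (overlap_defect _ _ _ g0 h0) _; rewrite ?ler0n//.
rewrite ler_wpM2l ?mulr_ge0 ?addr_ge0 ?ler0n//.
by rewrite lef_pV2.
Qed.
End labellings.

Section relabelling.
Context {R : realType} {n K : nat}.
Implicit Types g h : 'I_n -> 'I_K.

(** Written over pairs, the within-block sum of squares no longer involves block means, and for a
    column of [X] only pairs from different true classes contribute. *)
Lemma residual_pairs g (u : 'cV[R]_n) :
  dot u ((1%:M - projm g) *m u) =
  \sum_i \sum_j projm g i j * (u i 0 - u j 0) ^+ 2 / 2.
Proof.
have E1 : \sum_i \sum_j projm g i j * u i 0 ^+ 2 = dot u u.
  rewrite dotE; apply: eq_bigr => i _.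
  by rewrite -mulr_suml projm_row_sum mul1r.
have E2 : \sum_i \sum_j projm g i j * u j 0 ^+ 2 = dot u u.
  rewrite exchange_big -E1; apply: eq_bigr => i _; apply: eq_bigr => j _.
  by rewrite -[in LHS](projm_sym g) mxE.
have E3 : \sum_i \sum_j projm g i j * (u i 0 * u j 0) = dot u (projm g *m u).
  rewrite dotE; apply: eq_bigr => i _; rewrite mxE mulr_sumr; apply: eq_bigr => j _.
  by ring.
rewrite mulmxBl mul1mx dotBr -E3.
rewrite [LHS](_ : _ = (dot u u + dot u u) / 2
  - \sum_i \sum_j projm g i j * (u i 0 * u j 0)); last by field.
rewrite -{1}E1 -E2 -big_split /= mulr_suml -sumrB; apply: eq_bigr => i _.
rewrite -big_split /= mulr_suml -sumrB; apply: eq_bigr => j _.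
by field.
Qed.

(* Assigning to every block of [g] its majority class leaves at most
   [residual / D] points outside of their class. *)
Lemma residual_ge p (X : 'M[R]_(n, p)) (mu : 'M[R]_(K, p)) g h (D : R) :
  (forall i j, X i j = mu (h i) j) -> 0 <= D ->
  (forall k l, k != l -> 2 * D <= \sum_j (mu k j - mu l j) ^+ 2) ->
  exists phi : 'I_K -> 'I_K,
  D * #|[set i | h i != phi (g i)]%SET|%:R <=
    \sum_j dot (col j X) ((1%:M - projm g) *m col j X).
Proof.
move=> XE D0 sep.
pose N k l := #|(fiber g k :&: fiber h l)%SET|.
have [phi phiP] : exists phi : 'I_K -> 'I_K, forall k l, (N k l <= N k (phi k))%N.
  exists (fun k => [arg max_(l > k) N k l]%N) => k l.
  by case: arg_maxnP => // l' _; exact.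
exists phi.
(* Two points of one block of [g] in different true classes are at squared distance at least [2 D];
   the 2 cancels the half in [residual_pairs]. *)
apply: (@le_trans _ _ (\sum_i \sum_j D * (projm g i j * (h i != h j)%:R))); last first.
  under [leRHS]eq_bigr do rewrite residual_pairs.
  rewrite [leRHS]exchange_big /=; apply: ler_sum => i _.
  rewrite [leRHS]exchange_big /=; apply: ler_sum => j _.
  rewrite (eq_bigr (fun k => projm g i j / 2 * (mu (h i) k - mu (h j) k) ^+ 2)); last first.
    by move=> k _; rewrite [col k X i 0]mxE [col k X j 0]mxE !XE; field.
  rewrite -mulr_sumr.
  have P0 : 0 <= projm g i j :> R by rewrite mxE divr_ge0// ltW// fsize_gt0.
  have [hij|hij] := eqVneq (h i) (h j).
    by rewrite mulr0 mulr0 mulr_ge0 ?divr_ge0// sumr_ge0// => k _; rewrite sqr_ge0.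
  by have := sep _ _ hij; rewrite mulr1; set S := \sum_k _ => sepS; nra.
rewrite -sum1_card natr_sum mulr_sumr.
under [leRHS]eq_bigr do rewrite -mulr_sumr.
rewrite [leLHS]big_mkcond /=.
have fiberE i : \sum_j projm g i j * (h i != h j)%:R =
    1 - (N (g i) (h i))%:R / fsize g (g i) :> R.
  rewrite -[X in _ = X - _](projm_row_sum g i).
  rewrite (_ : (N _ _)%:R / _ = \sum_j projm g i j * (h i == h j)%:R).
    rewrite -sumrB; apply: eq_bigr => j _.
    by case: eqP => _ /=; rewrite ?mulr0 ?mulr1 ?subrr ?subr0.
  rewrite /N -sum1_card natr_sum big_mkcond /= mulr_suml; apply: eq_bigr => j _.
  rewrite !inE mxE [g i == _]eq_sym [h i == _]eq_sym.
  by case: eqP; case: eqP; rewrite /= ?mul0r ?mulr0 ?mulr1.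
under [leRHS]eq_bigr do rewrite fiberE.
rewrite [leLHS](_ : _ = \sum_i D * (1 - (h i == phi (g i))%:R)); last first.
  apply: eq_bigr => i _; rewrite inE; case: eqP => _ /=.
    by rewrite subrr mulr0.
  by rewrite subr0.
rewrite -!mulr_sumr ler_wpM2l// !sumrB lerD2l lerN2.
rewrite (partition_big g xpredT)//= [leRHS](partition_big g xpredT)//=.
apply: ler_sum => k _.
have [i0 /eqP gi0|k0] := pickP (fun i => g i == k); last by rewrite !big_pred0.
have fk : 0 < fsize g k :> R by rewrite -gi0 fsize_gt0.
rewrite (eq_bigr (fun i => (N k (h i))%:R / fsize g k)); last by move=> i /eqP ->.
(* The average of [N k (h i)] over the block is at most its largest value [N k (phi k)], which
   counts the points of the block in its majority class. *)
apply: (@le_trans _ _ (\sum_(i | g i == k) (N k (phi k))%:R / fsize g k)).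
  apply: ler_sum => i _; rewrite ler_pM2r ?invr_gt0// ler_nat; exact: phiP.
have -> : \sum_(i | g i == k) (N k (phi k))%:R / fsize g k = (N k (phi k))%:R :> R.
  rewrite (eq_bigl (fun i => i \in fiber g k)); last by move=> i; rewrite inE.
  by rewrite sumr_const -[LHS]mulr_natr -/(fsize g k) divfK ?gt_eqF.
rewrite /N -sum1_card natr_sum [leLHS]big_mkcond [leRHS]big_mkcond /=.
apply: ler_sum => i _; rewrite !inE.
by case: eqP => //= ->; case: eqP.
Qed.

(** The complements of [A] and of its image have the same cardinality, so the missing values are
    assigned by matching their enumerations. *)
Lemma extend_injection (T : finType) (A : {set T}) (f : T -> T) :
  {in A &, injective f} -> exists2 q : T -> T, injective q & {in A, q =1 f}.
Proof.
move=> injf; pose B := (~: (f @: A))%SET.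
have cB : #|B| = #|(~: A)%SET|.
  by apply/eqP; rewrite -(eqn_add2l #|(f @: A)%SET|) cardsC card_in_imset// cardsC.
pose q x := if x \in A then f x else nth x (enum B) (index x (enum (~: A)%SET)).
have qB x : x \notin A -> q x \in B.
  move=> xA; rewrite /q (negbTE xA) -mem_enum mem_nth// -cardE cB cardE index_mem mem_enum inE//.
exists q; last by move=> x xA; rewrite /q xA.
have qA x : x \in A -> q x \notin B.
  by move=> xA; rewrite /q xA !inE negbK imset_f.
move=> x y; have [xA|xA] := boolP (x \in A); have [yA|yA] := boolP (y \in A).
- by rewrite /q xA yA; exact: injf.
- by move=> e; have := qA _ xA; rewrite e qB.
- by move=> e; have := qA _ yA; rewrite -e qB.
- rewrite /q (negbTE xA) (negbTE yA).
  have ix : (index x (enum (~: A)%SET) < size (enum B))%N.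
    by rewrite -cardE cB cardE index_mem mem_enum inE.
  have iy : (index y (enum (~: A)%SET) < size (enum B))%N.
    by rewrite -cardE cB cardE index_mem mem_enum inE.
  rewrite (set_nth_default y)// => /eqP; rewrite nth_uniq ?enum_uniq// => /eqP.
  by move=> e; apply: (index_inj x _ _ e); rewrite mem_enum inE.
Qed.

(** One label per value of [phi] is kept, and the surplus labels are sent to the classes that [phi]
    misses. All points of a missed class are already errors of [phi], and there are as many missed
    classes as surplus labels; so, by balance, the points that lose a correct label are at most
    [gam] times the errors of [phi]. *)
Lemma relabel g h (phi : 'I_K -> 'I_K) (gam : R) :
  (forall k l, fsize h k <= gam * fsize h l :> R) -> 1 <= gam ->
  exists2 q : 'I_K -> 'I_K, injective q &
  (hamming (q \o g) h)%:R <= (1 + gam) * #|[set i | h i != phi (g i)]%SET|%:R :> R.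
Proof.
move=> bal gam1.
(* The result of [pick] depends only on [phi k], so [A] contains exactly one label for each value of
   [phi]. *)
pose A := [set k | [pick k' | phi k' == phi k] == Some k]%SET.
have injA : {in A &, injective phi}.
  by move=> k l; rewrite !inE => /eqP kA /eqP lA e; move: kA; rewrite e lA => -[].
have imA k : phi k \in (phi @: A)%SET.
  case: (@pickP _ (fun k' => phi k' == phi k)) => [k' /eqP e|/(_ k)]; last by rewrite eqxx.
  have [k'' e''] : exists k'', [pick k' | phi k' == phi k] = Some k''.
    by case: pickP => [k'' _|/(_ k)]; [exists k''|rewrite eqxx].
  have ek'' : phi k'' = phi k by move: e''; case: pickP => // z /eqP ez [<-].
  by rewrite -ek''; apply: imset_f; rewrite inE ek'' e''.
have [q injq qA] := extend_injection injA.
exists q => //.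
set S := [set i | h i != phi (g i)]%SET.
pose E := (~: A)%SET; pose I' := (~: (phi @: A))%SET.
have cE : #|E| = #|I'|.
  by apply/eqP; rewrite -(eqn_add2l #|A|) cardsC -(card_in_imset injA) cardsC.
have h1 : (hamming (q \o g) h <= #|S| + \sum_(k in E) #|fiber h (phi k) :&: fiber g k|)%N.
  apply: (@leq_trans #|(S :|: \bigcup_(k in E) (fiber h (phi k) :&: fiber g k))%SET|).
    apply: subset_leq_card; apply/fintype.subsetP => i; rewrite !inE /= => qi.
    have [hi|//] := eqVneq (h i) (phi (g i)).
    apply/bigcupP; exists (g i); rewrite !inE ?hi ?eqxx//.
    apply: contra qi => gA; rewrite qA ?hi// inE//.
  apply: leq_trans (leq_card_setU _ _) _; rewrite leq_add2l.
  elim/big_ind2: _ => [|x1 x2 y1 y2 h1 h2|k _]//; first by rewrite cards0.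
  exact: leq_trans (leq_card_setU _ _) (leq_add h1 h2).
have h2 : (\sum_(l in I') #|fiber h l| <= #|S|)%N.
  rewrite -sum1_card [leqRHS](partition_big h xpredT)//= [leqRHS](bigID (mem I'))/=.
  apply: leq_trans (leq_addr _ _); apply: leq_sum => l lI; rewrite -sum1_card.
  rewrite [leqLHS]big_mkcond [leqRHS]big_mkcond/=; apply: leq_sum => i _.
  rewrite !inE; case: eqP => //= hl; case: eqP => //= hi.
  by move: lI; rewrite inE -hl hi imA.
have [E0|[e eE]] := set_0Vmem E.
  move: h1; rewrite E0 big_set0 addn0 -(ler_nat R) => /le_trans; apply.
  by rewrite ler_peMl ?ler0n// lerDl (le_trans ler01).
have [l0 l0I] : exists l0, l0 \in I'.
  by apply/card_gt0P; rewrite -cE; apply/card_gt0P; exists e.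
have [lm _ lmin] := @arg_minnP _ l0 xpredT (fun l => #|fiber h l|) isT.
have h3 : #|E|%:R * fsize h lm <= #|S|%:R :> R.
  rewrite cE /fsize -natrM ler_nat; apply: leq_trans h2.
  by rewrite -sum_nat_const; apply: leq_sum => l _; exact: lmin.
have h4 : (\sum_(k in E) #|fiber h (phi k) :&: fiber g k|)%N%:R <= gam * (#|E|%:R * fsize h lm) :> R.
  rewrite natr_sum mulrCA mulr_natl -sumr_const; apply: ler_sum => k _.
  apply: le_trans (bal (phi k) lm); rewrite /fsize ler_nat.
  exact: subset_leq_card (finset.subsetIl _ _).
apply: (@le_trans _ _ (#|S|%:R + gam * (#|E|%:R * fsize h lm))).
  by apply: le_trans (lerD (lexx _) h4); rewrite -natrD ler_nat.
rewrite mulrDl mul1r lerD2l ler_wpM2l// (le_trans ler01)//.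
Qed.

Lemma projm_relabel g (q : 'I_K -> 'I_K) : injective q -> projm (q \o g) = projm g :> 'M[R]_n.
Proof.
move=> injq; apply/matrixP => i j; rewrite !mxE /= (inj_eq injq); congr (_ / _).
by rewrite !fsizeE; apply: eq_bigr => l _; rewrite /= (inj_eq injq).
Qed.
End relabelling.

(** * Deviation inequalities *)

Section deviations.
Context {R : realType} {d : measure_display} {Omega : measurableType d}.
Context (P : probability Omega R) {n p : nat}.
Variables (Y : {RV P >-> n.-tuple (p.-tuple R)}) (X : 'M[R]_(n, p)) (s : R).
Hypotheses (s0 : 0 < s) (gY : gaussian_data P Y X s).

Local Notation y w j := (data_col (Y w) j).

Lemma sum_single (j : 'I_p) (F : 'I_p -> 'M[R]_n -> R) (A : 'M[R]_n) :
  (forall k, F k 0 = 0) -> \sum_k F k (if k == j then A else 0) = F j A.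
Proof.
move=> F0; rewrite (bigD1 j)//= eqxx big1 ?addr0// => k /negbTE ->; exact: F0.
Qed.

(** With [l = 1 / (8 sqrt D)] the variance term [4 l^2 D] equals 1/16 and the deviation contributes
    [tau / 8]. Claiming only half of the signal energy leaves [l / 2] times that energy, which
    covers its share of the variance because [l <= 1/8]. *)
Lemma idem_lower_tail (Q : 'M[R]_n) (D tau : R) j : sym_idem Q -> \tr Q = D -> 1 <= D ->
  (P [set w | (dot (y w j) (Q *m y w j) <= s ^+ 2 * (D - tau * Num.sqrt D)
        + dot (col j X) (Q *m col j X) / 2)%R]
    <= (expR (1 / 16 - tau / 8))%:E)%E.
Proof.
move=> sQ trQ D1; set x := col j X; set xi := dot x (Q *m x).
have D0 : 0 < D by lra.
have r1 : 1 <= Num.sqrt D by rewrite -sqrtr1 ler_wsqrtr.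
have rD : Num.sqrt D ^+ 2 = D by rewrite sqr_sqrtr// ltW.
set r := Num.sqrt D in r1 rD *; have r0 : 0 < r by lra.
pose A (k : 'I_p) : 'M[R]_n := if k == j then - Q else 0.
have cA k : contraction (A k).
  by rewrite /A; case: eqP => _; [exact: contractionN_idem|exact: contraction0].
pose l := (8 * r)^-1.
have lr : l * r = 1 / 8 by rewrite /l; field; rewrite gt_eqF.
have l0 : 0 < l by rewrite invr_gt0 mulr_gt0.
have l8 : l <= 1 / 8 by nra.
have l4 : 0 <= l <= 1 / 4 by apply/andP; split; lra.
have s2 : 0 < s ^+ 2 by rewrite exprn_gt0.
have := gaussian_quadratic_tail (- (D - tau * r) - xi / 2 / s ^+ 2) s0 gY cA l4.
rewrite (sum_single j (F := fun k B => quad_bound B (col k X) s l)); last first.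
  by move=> k; exact: quad_bound0.
set S := [set w | _]; set S' := [set w | _]; have -> : S = S'.
  apply/seteqP; split => w; rewrite /S /S' /=;
  rewrite (sum_single j (F := fun k B => dot (y w k) (B *m y w k)));
    try by move=> k; rewrite mul0mx dot0r.
    rewrite mulNmx dotNr => h; rewrite -lerN2 (le_trans _ h)//.
    by rewrite mulrBl divfK ?gt_eqF//; lra.
  move=> h; rewrite mulNmx dotNr -lerN2 opprK (le_trans h)//.
  by rewrite mulrBl divfK ?gt_eqF//; lra.
move=> /le_trans; apply; rewrite lee_fin ler_expR.
rewrite /quad_bound -/x !mulNmx !mulmxN opprK sQ.2 !raddfN /= !dotNr dotNl opprK trQ.
rewrite sym_idem_normE// -/xi.
have xi0 : 0 <= xi / s ^+ 2 by apply: divr_ge0; [exact: sym_idem_ge0|exact: ltW].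
have -> : l * - xi / s ^+ 2 = - (l * (xi / s ^+ 2)) by ring.
rewrite (_ : xi / 2 / s ^+ 2 = (xi / s ^+ 2) / 2); last by ring.
set u := xi / s ^+ 2 in xi0 *.
have h1 : l * (tau * r) = tau / 8 by rewrite mulrCA lr; lra.
have h2 : l ^+ 2 * D = 1 / 64 by rewrite -rD -exprMn lr expr2; lra.
have h3 : l ^+ 2 * u <= l * u / 8.
  rewrite -subr_ge0 (_ : _ - _ = l * u * (1 / 8 - l)); last by ring.
  by apply: mulr_ge0; [apply: mulr_ge0 => //; exact: ltW|lra].
lra.
Qed.

Lemma idem_upper_tail (Q : 'M[R]_n) (D tau : R) j : sym_idem Q -> \tr Q = D -> 1 <= D ->
  col j X = 0 ->
  (P [set w | (s ^+ 2 * (D + tau * Num.sqrt D) <= dot (y w j) (Q *m y w j))%R]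
    <= (expR (1 / 16 - tau / 8))%:E)%E.
Proof.
move=> sQ trQ D1 xj0.
have D0 : 0 < D by lra.
have r1 : 1 <= Num.sqrt D by rewrite -sqrtr1 ler_wsqrtr.
have rD : Num.sqrt D ^+ 2 = D by rewrite sqr_sqrtr// ltW.
set r := Num.sqrt D in r1 rD *; have r0 : 0 < r by lra.
pose A (k : 'I_p) : 'M[R]_n := if k == j then Q else 0.
have cA k : contraction (A k).
  by rewrite /A; case: eqP => _; [exact: contraction_idem|exact: contraction0].
pose l := (8 * r)^-1.
have lr : l * r = 1 / 8 by rewrite /l; field; rewrite gt_eqF.
have l0 : 0 < l by rewrite invr_gt0 mulr_gt0.
have l8 : l <= 1 / 8 by nra.
have l4 : 0 <= l <= 1 / 4 by apply/andP; split; lra.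
have := gaussian_quadratic_tail (D + tau * r) s0 gY cA l4.
rewrite (sum_single j (F := fun k B => quad_bound B (col k X) s l)); last first.
  by move=> k; exact: quad_bound0.
set S := [set w | _]; set S' := [set w | _]; have -> : S = S'.
  apply/seteqP; split => w; rewrite /S /S' /= mulrC;
  by rewrite (sum_single j (F := fun k B => dot (y w k) (B *m y w k)))// => k; rewrite mul0mx dot0r.
move=> /le_trans; apply; rewrite lee_fin ler_expR.
rewrite /quad_bound xj0 !mulmx0 !dot0r sQ.2 trQ !(mulr0, mul0r, addr0, add0r).
have h1 : l * (tau * r) = tau / 8 by rewrite mulrCA lr; lra.
have h2 : l ^+ 2 * D = 1 / 64 by rewrite -rD -exprMn lr expr2; lra.
lra.
Qed.

(** Both projections have trace [K], so the noise cancels in the mean, and [P_h] fixes the columns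
    of [X], so the mean is minus the residual. For [l <= 1/8], half of this negative mean absorbs
    the variance due to the signal; the other half stays in the exponent. *)
Lemma projm_diff_tail K (g h : 'I_n -> 'I_K) (mu : 'M[R]_(K, p)) (J : {set 'I_p}) (V l t : R) :
  (forall i j, X i j = mu (h i) j) ->
  (forall k, exists i, g i = k) -> (forall k, exists i, h i = k) ->
  \tr ((projm g - projm h) *m (projm g - projm h)) <= V -> 0 <= l <= 1 / 8 ->
  (P [set w | (t * s ^+ 2 <= \sum_(j in J)
        (dot (y w j) (projm g *m y w j) - dot (y w j) (projm h *m y w j)))%R]
    <= (expR (4 * l ^+ 2 * #|J|%:R * V - l * (t +
        (\sum_(j in J) dot (col j X) ((1%:M - projm g) *m col j X)) / s ^+ 2 / 2)))%:E)%E.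
Proof.
move=> XE sg sh trV /andP[l0 l8].
have ig : sym_idem (projm g : 'M[R]_n) := sym_idem_projm g.
have ih : sym_idem (projm h : 'M[R]_n) := sym_idem_projm h.
pose B : 'M[R]_n := projm g - projm h.
pose A (k : 'I_p) : 'M[R]_n := if k \in J then B else 0.
have cA k : contraction (A k).
  by rewrite /A; case: ifP => _; [exact: contraction_sub|exact: contraction0].
have l4 : 0 <= l <= 1 / 4 by apply/andP; split; lra.
have s2 : 0 < s ^+ 2 by rewrite exprn_gt0.
have := gaussian_quadratic_tail t s0 gY cA l4.
set S := [set w | _]; set S' := [set w | _]; have -> : S = S'.
  have E w : \sum_j dot (y w j) (A j *m y w j) = \sum_(j in J)
      (dot (y w j) (projm g *m y w j) - dot (y w j) (projm h *m y w j)).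
    rewrite [RHS]big_mkcond; apply: eq_bigr => j _; rewrite /A; case: ifP => _.
      by rewrite mulmxBl dotBr.
    by rewrite mul0mx dot0r.
  by apply/seteqP; split => w; rewrite /S /S' /= E.
move=> /le_trans; apply; rewrite lee_fin ler_expR.
rewrite mulrDr opprD addrCA addrC lerD2r.
pose z j := dot (col j X) ((1%:M - projm g) *m col j X) / s ^+ 2.
have bnd j : quad_bound B (col j X) s l <= 4 * l ^+ 2 * V - l * (z j / 2).
  have fx : projm h *m col j X = col j X.
    by apply: (projm_fixed (f := fun k => mu k j)) => i; rewrite mxE XE.
  have Bx : B *m col j X = - ((1%:M - projm g) *m col j X).
    by rewrite !mulmxBl fx mul1mx opprB.
  have i1g : sym_idem (1%:M - projm g : 'M[R]_n).
    split; first by rewrite raddfB /= trmx1 ig.1.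
    by rewrite mulmxBl mul1mx mulmxBr mulmx1 ig.2 subrr subr0.
  rewrite /quad_bound Bx dotNr dotNl dotNr opprK sym_idem_normE//.
  rewrite (_ : \tr B = 0); last by rewrite /B raddfB /= !projm_trace// subrr.
  rewrite (_ : l * - _ / s ^+ 2 = - (l * z j)); last by rewrite /z; ring.
  rewrite -/(z j).
  have z0 : 0 <= z j by apply: divr_ge0; [exact: sym_idem_ge0|exact: ltW].
  rewrite -/B in trV; have := sqr_ge0 l.
  have : l ^+ 2 * z j <= l * z j / 8.
    rewrite -subr_ge0 (_ : _ - _ = l * z j * (1 / 8 - l)); last by ring.
    by apply: mulr_ge0; [exact: mulr_ge0|lra].
  move: trV; set a := \tr _ => trV h1 h2.
  have : l ^+ 2 * a <= l ^+ 2 * V by rewrite ler_wpM2l.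
  lra.
apply: (@le_trans _ _ (\sum_(j in J) (4 * l ^+ 2 * V - l * (z j / 2)))).
  rewrite [leRHS]big_mkcond; apply: ler_sum => j _; rewrite /A; case: ifP => _ //.
  by rewrite quad_bound0.
rewrite sumrB sumr_const -mulr_sumr -!mulr_suml -[X in X - _]mulr_natr.
by rewrite le_eqVlt; apply/orP; left; apply/eqP; ring.
Qed.
End deviations.

(** * Sums of weights over labellings and column sets *)

Section counting.
Context {R : realType}.

Lemma sum_set_symdiff (T : finType) (J0 : {set T}) (x : R) :
  \sum_(J : {set T}) x ^+ #|(J :\: J0 :|: J0 :\: J)%SET| = (1 + x) ^+ #|T|.
Proof.
pose F i := if i \in J0 then 1 else x; pose G i := if i \in J0 then x else 1.
transitivity (\prod_(i : T) (F i + G i)).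
  rewrite bigA_distr; apply: eq_big => [J|J _]; first by rewrite ?inE.
  rewrite -prodr_const big_mkcond; apply: eq_bigr => i _; rewrite !inE /F /G.
  by case: (i \in J); case: (i \in J0).
rewrite -(prodr_const T); apply: eq_bigr => i _; rewrite /F /G.
by case: ifP => // _; rewrite addrC.
Qed.

Lemma sum_ffun_hamming n K (h : {ffun 'I_n -> 'I_K}) (x : R) :
  \sum_(g : {ffun 'I_n -> 'I_K}) x ^+ hamming g h = (1 + K.-1%:R * x) ^+ n.
Proof.
transitivity (\prod_(i : 'I_n) \sum_(k : 'I_K) (if k != h i then x else 1)).
  rewrite bigA_distr_bigA; apply: eq_bigr => g _.
  rewrite /hamming -prodr_const big_mkcond; apply: eq_bigr => i _.
  by rewrite inE.
rewrite -[n in RHS]card_ord -(prodr_const 'I_n); apply: eq_bigr => i _.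
rewrite (bigD1 (h i))//= eqxx /=; congr (_ + _).
rewrite (eq_bigr (fun=> x)); last by move=> k ->.
rewrite sumr_const -[LHS]mulr_natl; congr (_%:R * _).
have := cardC1 (h i); rewrite card_ord => <-.
by apply: eq_card => k; rewrite !inE.
Qed.

Lemma expr1D_le (x : R) m : 0 <= x -> m%:R * x <= 1 / 2 -> (1 + x) ^+ m <= 1 + 2 * (m%:R * x).
Proof.
elim: m => [|m IH] x0 mx; first by rewrite expr0 mul0r mulr0 addr0.
move: mx; rewrite -natr1 mulrDl mul1r => mx.
have := IH x0; rewrite exprS => h.
have m0 : 0 <= m%:R * x by rewrite mulr_ge0.
have := h ltac:(lra) => h'.
apply: (@le_trans _ _ ((1 + x) * (1 + 2 * (m%:R * x)))); first by rewrite ler_wpM2l//; lra.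
nra.
Qed.

Lemma union_bound d (Omega : measurableType d) (P : probability Omega R) (I : finType)
    (B : I -> set Omega) (b : I -> R) :
  (forall i, measurable (B i)) -> (forall i, (P (B i) <= (b i)%:E)%E) ->
  (P [set w | exists i, B i w] <= (\sum_i b i)%:E)%E.
Proof.
move=> mB Bb; rewrite (_ : [set _ | _] = \big[setU/set0]_(i : I) B i); last first.
  by rewrite -bigcup_seq; apply/seteqP; split => w [i h]; exists i => //=; rewrite mem_index_enum.
suff [] : measurable (\big[setU/set0]_(i : I) B i) /\
    (P (\big[setU/set0]_(i : I) B i) <= (\sum_i b i)%:E)%E by [].
elim/big_ind2 : _ => [|A a A' a' [mA Aa] [mA' Aa']|i _]; last by split.
- by rewrite measure0.
- split; first exact: measurableU.
  by apply: le_trans (measureU2 P mA mA') _; rewrite EFinD leeD.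
Qed.
End counting.

(** * The estimator *)

Section sparse_kmeans.
Context {R : realType} (n p K s : nat).

Definition candidate : finType := ({ffun 'I_n -> 'I_K} * {set 'I_p} * 'I_p)%type.

(** Surjectivity gives every candidate projection the same rank [K], so that in the mean the noise
    favours no labelling. *)
Definition valid (c : candidate) : bool :=
  [forall k, exists i, c.1.1 i == k] && (#|c.1.2| <= s)%N.

(* [theta * |Y_{:j0}|^2] is the price of a selected column. The column [j0] is
   part of the candidate, so that maximizing puts the smallest column norm,
   an estimate of [n sigma^2], in its place. *)
Definition crit (theta : R) (c : candidate) (y : n.-tuple (p.-tuple R)) : R :=
  \sum_(j in c.1.2) (dot (data_col y j) (projm c.1.1 *m data_col y j)
                     - theta * dot (data_col y c.2) (data_col y c.2)).

Lemma measurable_crit theta c : measurable_fun setT (crit theta c).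
Proof.
rewrite (_ : crit theta c = fun y => \sum_j if j \in c.1.2 then
    dot (data_col y j) (projm c.1.1 *m data_col y j)
    - theta * dot (data_col y c.2) (data_col y c.2) else 0); last first.
  by apply/funext => y; rewrite /crit big_mkcond.
apply: measurable_sum => j.
case: (j \in c.1.2) => //; apply: measurable_funB; first exact: measurable_data_quadratic.
apply: measurable_funM => //.
by apply: measurable_dot => i; exact: measurable_data_col.
Qed.

(** The data determine the maximizer only through this finite table, so the fibres of the estimator
    are finite unions of sets cut out by comparing measurable functions. *)
Definition comparisons theta (y : n.-tuple (p.-tuple R)) : {ffun candidate * candidate -> bool} :=
  [ffun cc => crit theta cc.2 y <= crit theta cc.1 y].

Definition label_blocks (g : 'I_n -> 'I_K) : {set {set 'I_n}} := blocks (fiber g).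

(** On a table produced by [comparisons], the default [g0] is reached only when no candidate is
    valid, for instance when [p = 0]. *)
Definition selection (g0 : 'I_n -> 'I_K) (b : {ffun candidate * candidate -> bool}) :
    {set {set 'I_n}} :=
  if [pick c | valid c && [forall c', valid c' ==> b (c, c')]] is Some c
  then label_blocks c.1.1 else label_blocks g0.

Definition kmeans theta g0 (x : n.-tuple (p.-tuple R) * unit) : {set {set 'I_n}} :=
  selection g0 (comparisons theta x.1).

Lemma measurable_kmeans theta g0 Q : measurable [set x | kmeans theta g0 x = Q].
Proof.
rewrite (_ : [set _ | _] = \bigcup_(b in [set` [pred b | selection g0 b == Q]])
    [set x | forall cc, (crit theta cc.2 x.1 <= crit theta cc.1 x.1) = b cc]).
  apply: fin_bigcup_measurable => [|b _]; first exact: finite_finset.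
  apply: measurable_forall => cc.
  pose D (x : n.-tuple (p.-tuple R) * unit) : R := crit theta cc.1 x.1 - crit theta cc.2 x.1.
  have mD : measurable_fun setT D.
    by apply: measurable_funB; exact: (measurableT_comp (measurable_crit _ _) measurable_fst).
  have mD0 : measurable (D @^-1` `[0, +oo[).
    by rewrite -[X in measurable X]setTI; exact: mD.
  case: (b cc).
    rewrite [X in measurable X](_ : _ = D @^-1` `[0, +oo[)//.
    by apply/seteqP; split => x; rewrite /= in_itv /= andbT subr_ge0.
  rewrite [X in measurable X](_ : _ = ~` (D @^-1` `[0, +oo[)); first exact: measurableC.
  by apply/seteqP; split => x; rewrite /= in_itv /= andbT subr_ge0; [move=> ->|move/negP/negbTE].
apply/seteqP; split => [x /= xQ|x [b /= /eqP <- h]].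
  exists (comparisons theta x.1); first by rewrite /= inE; apply/eqP.
  by move=> cc; rewrite ffunE.
by rewrite /kmeans; congr selection; apply/ffunP => cc; rewrite ffunE h.
Qed.

Lemma label_blocks_partition (g : 'I_n -> 'I_K) : (forall k, exists i, g i = k) ->
  finset.partition (label_blocks g) [set: 'I_n]%SET /\ #|label_blocks g| = K.
Proof.
move=> surj; split.
  apply/and3P; split.
  - rewrite finset.eqEsubset finset.subsetT /=; apply/fintype.subsetP => i _.
    by apply/bigcupP; exists (fiber g (g i)); [exact: imset_f|rewrite inE].
  - apply/finset.trivIsetP => _ _ /imsetP[k _ ->] /imsetP[l _ ->] kl.
    rewrite -finset.setI_eq0; apply/eqP/setP => i; rewrite !inE; apply/negP => /andP[/eqP gk /eqP gl].
    by move: kl; rewrite -gk -gl eqxx.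
  - apply/imsetP => -[k _ /setP e]; have [i gi] := surj k.
    by have := e i; rewrite !inE gi eqxx.
rewrite card_imset ?card_ord// => k l /setP e; have [i gi] := surj k.
by have := e i; rewrite !inE gi eqxx => /esym/eqP.
Qed.

Lemma kmeans_partition theta g0 x : (forall k, exists i, g0 i = k) ->
  finset.partition (kmeans theta g0 x) [set: 'I_n]%SET /\ #|kmeans theta g0 x| = K.
Proof.
move=> surj; rewrite /kmeans /selection; case: pickP => [c /andP[/andP[/forallP vc _] _]|_].
  apply: label_blocks_partition => k; have /existsP[i /eqP gi] := vc k; by exists i.
exact: label_blocks_partition.
Qed.

Lemma label_blocks_comp (g : 'I_n -> 'I_K) (q : 'I_K -> 'I_K) :
  injective q -> label_blocks (q \o g) = label_blocks g.
Proof.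
move=> injq; have [q' qK q'K] := injF_bij injq.
have E k : fiber (q \o g) (q k) = fiber g k.
  by apply/setP => i; rewrite !inE /= (inj_eq injq).
apply/setP => B; apply/imsetP/imsetP => -[k _ ->].
  by exists (q' k) => //; rewrite -E q'K.
by exists (q k) => //; rewrite E.
Qed.

Lemma kmeansP theta g0 x : (exists c, valid c) ->
  exists c, [/\ valid c, forall c', valid c' -> crit theta c' x.1 <= crit theta c x.1 &
    kmeans theta g0 x = label_blocks c.1.1].
Proof.
move=> [c0 vc0]; rewrite /kmeans /selection; case: pickP => [c /andP[vc /forallP h]|no].
  exists c; split => // c' vc'; have := h c'; by rewrite vc' ffunE.
have [c vc cmax] := @Order.TotalTheory.arg_maxP _ _ _ c0 valid (crit theta ^~ x.1) vc0.
have := no c; rewrite vc => /negbT/forallPn[c']; rewrite negb_imply ffunE => /andP[vc'].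
by have /= -> := cmax c' vc'.
Qed.
End sparse_kmeans.

(** * Consequences of the model *)

Section model.
Context {R : realType} {n p K : nat}.

(** Covering gives every point a label; disjointness and the injectivity of [G] make it unique,
    which leaves one term in [mean_matrix]. Independence of the rows and the product law of each row
    combine into one formula on boxes. *)
Lemma model_labels d (Omega : measurableType d) (P : probability Omega R) s
    (Y : {RV P >-> n.-tuple (p.-tuple R)}) sigma J (mu : 'M[R]_(K, p)) G :
  sparse_clustering_model s Y sigma J mu G ->
  exists h : 'I_n -> 'I_K, [/\ G = fiber h, forall k, exists i, h i = k,
    forall i j, mean_matrix mu G i j = mu (h i) j & gaussian_data P Y (mean_matrix mu G) sigma].
Proof.
move=> [[partG injG] _ indep gauss].
have [/eqP covG trivG nG] := and3P partG.
have hG i : exists k, i \in G k.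
  have : i \in finset.cover (blocks G) by rewrite covG inE.
  by move=> /bigcupP[_ /imsetP[k _ ->] ik]; exists k.
pose h i := projT1 (cid (hG i)); have hP i : i \in G (h i) := projT2 (cid (hG i)).
have Gh i k : (i \in G k) = (h i == k).
  apply/idP/eqP => [ik|<-//]; apply: injG.
  rewrite -(finset.def_pblock trivG (imset_f G _) ik)//.
  by rewrite -(finset.def_pblock trivG (imset_f G _) (hP i)).
have GE : G = fiber h by apply/funext => k; apply/setP => i; rewrite inE Gh.
have XE i j : mean_matrix mu G i j = mu (h i) j.
  rewrite mxE (eq_bigl (pred1 (h i))) ?big_pred1_eq// => k.
  by rewrite Gh /= eq_sym.
exists h; split => //.
- move=> k; have : G k != finset.set0.
    by apply: contraNneq nG => <-; exact: imset_f.
  by move=> /set0Pn[i]; rewrite Gh => /eqP; exists i.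
- move=> A mA.
  pose B i : set (p.-tuple R) := [set z | forall j, A i j (tnth z j)].
  have mB i : measurable (B i).
    apply: measurable_forall => j; rewrite -[X in measurable X]setTI.
    exact: measurable_tnth.
  have := indep [set: 'I_n]%SET B mB.
  rewrite (_ : \bigcap_(i in _) _ = [set w | forall i j, A i j (tnth (tnth (Y w) i) j)]).
    move=> ->; rewrite big_mkcond; apply: eq_bigr => i _; rewrite inE.
    apply: etrans (gauss (h i) i (hP i) (A i) (mA i)) _.
    by apply: eq_bigr => j _; rewrite XE.
  apply/seteqP; split => w /=; first by move=> H i j; apply: (H i); rewrite /= inE.
  by move=> H i _ j; exact: H.
Qed.

Lemma balanced_fsize (h : 'I_n -> 'I_K) (gam : R) :
  (forall k, exists i, h i = k) -> balanced (fiber h) gam ->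
  forall k l, fsize h k <= gam * fsize h l.
Proof.
move=> surj bal k l; pose A : set R := [set fsize h m | m in [set: 'I_K]].
have f1 m : 1 <= fsize h m :> R.
  have [i <-] := surj m; rewrite /fsize ler1n; apply/card_gt0P; exists i.
  by rewrite inE.
have fn m : fsize h m <= n%:R :> R.
  by rewrite /fsize ler_nat -[n in leqRHS]card_ord max_card.
(* Nonempty blocks keep the infimum positive, so the quotient in [balanced] is not a division by
   zero. *)
have inf1 : 1 <= inf A by apply: lb_le_inf => [|_ [m _ <-]]; [exists (fsize h k), k|exact: f1].
have infA : inf A <= fsize h l.
  by apply: ge_inf; [exists 1 => _ [m _ <-]; exact: f1|exists l].
have supA : fsize h k <= sup A.
  by apply: ub_le_sup; [exists n%:R => _ [m _ <-]; exact: fn|exists k].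
have inf0 : 0 < inf A by lra.
have : sup A <= gam * inf A by rewrite -ler_pdivrMr.
have gam0 : 0 <= gam.
  by apply: le_trans bal; rewrite divr_ge0 -/A ?ltW//; have := f1 k; lra.
have := ler_wpM2l gam0 infA; lra.
Qed.

Lemma balanced_fsize_ge (h : 'I_n -> 'I_K) (gam : R) : 0 < gam ->
  (forall k l, fsize h k <= gam * fsize h l) -> (0 < K)%N ->
  forall l, n%:R / (K%:R * gam) <= fsize h l.
Proof.
move=> gam0 bal K0 l; rewrite ler_pdivrMr ?mulr_gt0 ?ltr0n//.
have -> : n%:R = \sum_(k < K) fsize h k :> R.
  rewrite -[n in LHS]card_ord -sum1_card natr_sum (partition_big h xpredT)//=.
  apply: eq_bigr => k _; rewrite fsizeE big_mkcond /=.
  by apply: eq_bigr => i _; case: ifP.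
apply: (@le_trans _ _ (\sum_(k < K) gam * fsize h l)); first by apply: ler_sum => k _; exact: bal.
by rewrite sumr_const card_ord -[X in X <= _]mulr_natl mulrA mulrC.
Qed.

Lemma separation2_le (mu : 'M[R]_(K, p)) sigma k l : 0 < sigma -> k != l ->
  2 * (sigma ^+ 2 * separation2 mu sigma) <= \sum_j (mu k j - mu l j) ^+ 2.
Proof.
move=> s0 kl; have s2 : 0 < 2 * sigma ^+ 2 by rewrite mulr_gt0// exprn_gt0.
rewrite mulrA mulrC -ler_pdivlMr//; apply: ge_inf; last by exists (k, l).
exists 0 => _ [kl' _ <-]; rewrite divr_ge0 ?(ltW s2)// sumr_ge0// => j _.
by rewrite sqr_ge0.
Qed.

(** Each label is paired with its cyclic successor, distinct because [K >= 2]. As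
    [|a - b|^2 <= 2 |a|^2 + 2 |b|^2], every pair carries energy at least [D], and every label occurs
    in two pairs. *)
Lemma sum_mean_ge (mu : 'M[R]_(K, p)) (D : R) : (1 < K)%N ->
  (forall k l, k != l -> 2 * D <= \sum_j (mu k j - mu l j) ^+ 2) ->
  K%:R * D / 2 <= \sum_k \sum_j mu k j ^+ 2.
Proof.
move=> K1 sep; pose N k := \sum_j mu k j ^+ 2.
have pair k : D <= N k + N (ordS k).
  have kS : k != ordS k.
    apply/eqP => /(congr1 val) /=; have kK := ltn_ord k.
    case: (ltnP k.+1 K) => [kK'|Kk]; first by rewrite modn_small//; lia.
    have -> : k.+1 = K by lia.
    by rewrite modnn; lia.
  have : \sum_j (mu k j - mu (ordS k) j) ^+ 2 <= 2 * (N k + N (ordS k)).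
    rewrite /N -big_split /= mulr_sumr; apply: ler_sum => j _.
    have := sqr_ge0 (mu k j + mu (ordS k) j); nra.
  by have := sep _ _ kS; lra.
have E : \sum_k N (ordS k) = \sum_k N k.
  by rewrite [RHS](reindex_inj (@ordS_inj K)).
have : \sum_(k < K) D <= \sum_k (N k + N (ordS k)) by apply: ler_sum => k _; exact: pair.
rewrite big_split /= E sumr_const card_ord -[X in X <= _]mulr_natl; rewrite -/(N _); lra.
Qed.

(** By balance every mean is repeated at least [n / (K gam)] times, so [sum_mean_ge] bounds the
    total energy from below. This energy is spread over at most [s] columns, and homogeneity passes
    from the largest column to the smallest at the cost of [eta]. *)
Lemma signal_column_ge (X : 'M[R]_(n, p)) (mu : 'M[R]_(K, p)) (h : 'I_n -> 'I_K)
    (J : {set 'I_p}) (s : nat) (D gam eta : R) :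
  (1 < K)%N -> 0 < gam -> 0 <= D ->
  (forall i j, X i j = mu (h i) j) -> (forall k j, j \notin J -> mu k j = 0) -> (#|J| <= s)%N ->
  (forall k l, k != l -> 2 * D <= \sum_j (mu k j - mu l j) ^+ 2) ->
  (forall k l, fsize h k <= gam * fsize h l) -> 0 <= eta -> homogeneous X J eta ->
  forall j, j \in J -> n%:R * D / (2 * gam) <= s%:R * eta * dot (col j X) (col j X).
Proof.
move=> K1 gam0 D0 XE muJ Js sep bal eta0 [].
set A := [set _ | _ in _] => inf0 hom j jJ.
have colE l : dot (col l X) (col l X) = col_norm2 X l.
  by rewrite dotE; apply: eq_bigr => i _; rewrite mxE expr2.
have A0 l : 0 <= col_norm2 X l by rewrite -colE dot_ge0.
have infj : inf A <= dot (col j X) (col j X).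
  by rewrite colE; apply: ge_inf; [exists 0 => _ [l _ <-]|exists j].
have supl l : l \in J -> col_norm2 X l <= sup A.
  move=> lJ; apply: ub_le_sup; last by exists l.
  exists (\sum_k col_norm2 X k) => _ [k _ <-].
  by rewrite (bigD1 k)//= lerDl sumr_ge0.
have tot : \sum_l col_norm2 X l <= s%:R * eta * inf A.
  apply: (@le_trans _ _ (\sum_(l in J) sup A)).
    rewrite [leRHS]big_mkcond; apply: ler_sum => l _; case: ifP => lJ; first exact: supl.
    by rewrite /col_norm2 big1// => i _; rewrite XE muJ ?lJ// expr0n.
  rewrite sumr_const -[X in X <= _]mulr_natl -mulrA.
  apply: (@le_trans _ _ (#|J|%:R * (eta * inf A))); first by rewrite ler_wpM2l.
  by rewrite ler_wpM2r ?ler_nat// mulr_ge0// ltW.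
have K0 : 0 < K%:R :> R by rewrite ltr0n; lia.
have low : n%:R / (K%:R * gam) * (K%:R * D / 2) <= \sum_l col_norm2 X l.
  apply: le_trans (ler_wpM2l _ (sum_mean_ge K1 sep)) _; first by rewrite divr_ge0// mulr_ge0// ltW.
  rewrite mulr_sumr exchange_big /=.
  have -> : \sum_i \sum_l X i l ^+ 2 = \sum_k fsize h k * \sum_l mu k l ^+ 2.
    rewrite (partition_big h xpredT)//=; apply: eq_bigr => k _.
    rewrite fsizeE mulr_suml big_mkcond /=; apply: eq_bigr => i _.
    case: eqP => [hi|_]; last by rewrite mul0r.
    by rewrite mul1r; apply: eq_bigr => l _; rewrite XE hi.
  apply: ler_sum => k _; rewrite ler_wpM2r//.
    by rewrite sumr_ge0// => l _; rewrite sqr_ge0.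
  by apply: balanced_fsize_ge => //; lia.
have -> : n%:R * D / (2 * gam) = n%:R / (K%:R * gam) * (K%:R * D / 2).
  by field; rewrite !gt_eqF.
apply: le_trans low (le_trans tot _).
by rewrite ler_wpM2l// mulr_ge0.
Qed.
End model.

(** * Analysis of a maximizer *)

Section selection.
Context {R : realType} {n p K s : nat}.
Variables (X : 'M[R]_(n, p)) (h : {ffun 'I_n -> 'I_K}) (J : {set 'I_p}) (v tau : R).

Local Notation kap := (Num.sqrt (K%:R : R)).
Local Notation cand g A j := ((g, A, j) : candidate n p K).
Local Notation nu := (Num.sqrt (n%:R : R)).

Definition energy (g : 'I_n -> 'I_K) (y : n.-tuple (p.-tuple R)) j :=
  dot (data_col y j) (projm g *m data_col y j).

Definition norm2 (y : n.-tuple (p.-tuple R)) j := dot (data_col y j) (data_col y j).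

Definition xnorm2 j := dot (col j X) (col j X).

(** Only the true labelling is controlled column by column; the norms serve to estimate the noise
    level. *)
Definition good_columns (y : n.-tuple (p.-tuple R)) :=
  forall j, [/\ v * (K%:R - tau * kap) + xnorm2 j / 2 < energy h y j,
    v * (n%:R - tau * nu) < norm2 y j,
    j \notin J -> energy h y j < v * (K%:R + tau * kap) &
    j \notin J -> norm2 y j < v * (n%:R + tau * nu)].

Lemma sum_constr (A : {set 'I_p}) (a : R) : \sum_(j in A) a = #|A|%:R * a.
Proof. by rewrite sumr_const -[LHS]mulr_natl. Qed.

Lemma critE theta (c : candidate n p K) y :
  crit theta c y = \sum_(j in c.1.2) (energy c.1.1 y j - theta * norm2 y c.2).
Proof. by []. Qed.

Lemma crit0E (c : candidate n p K) y : crit 0 c y = \sum_(j in c.1.2) energy c.1.1 y j.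
Proof. by rewrite critE; apply: eq_bigr => j _; rewrite mul0r subr0. Qed.

Lemma sum_sub_symdiff (f : 'I_p -> R) (A B : {set 'I_p}) :
  \sum_(j in A) f j - \sum_(j in B) f j = \sum_(j in A :\: B) f j - \sum_(j in B :\: A) f j.
Proof.
rewrite (big_setID B) [in X in _ - X](big_setID A) /= [in X in _ - X]finset.setIC.
by rewrite opprD addrACA subrr add0r.
Qed.

Definition excess g (A : {set 'I_p}) y := \sum_(j in A) (energy g y j - energy h y j).

Definition missed (A : {set 'I_p}) := \sum_(j in J :\: A) xnorm2 j.

Definition symdiff (A B : {set 'I_p}) : {set 'I_p} := (A :\: B :|: B :\: A)%SET.

Lemma card_symdiff A B : #|symdiff A B| = (#|A :\: B| + #|B :\: A|)%N.
Proof.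
rewrite cardsU (_ : (A :\: B) :&: (B :\: A) = finset.set0)%SET ?cards0 ?subn0//.
by apply/setP => j; rewrite !inE; case: (j \in A); case: (j \in B).
Qed.

Section maximizer.
Variables (theta : R) (c : candidate n p K) (y : n.-tuple (p.-tuple R)).
Hypotheses (hsurj : forall k, exists i, h i = k) (Js : (#|J| <= s)%N).
Hypothesis good : good_columns y.
Hypothesis vc : valid s c.
Hypothesis cmax : forall c' : candidate n p K, valid s c' -> crit theta c' y <= crit theta c y.
Hypotheses (v0 : 0 < v) (tau1 : 1 <= tau) (K1 : (1 < K)%N).

Lemma valid_truth (A : {set 'I_p}) (j : 'I_p) : (#|A| <= s)%N -> valid s (cand h A j).
Proof.
move=> As; apply/andP; split => //=; apply/forallP => k.
by have [i hi] := hsurj k; apply/existsP; exists i; apply/eqP.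
Qed.

Let k1 : 1 <= kap.
Proof. by rewrite -[leLHS]sqrtr1 ler_wsqrtr// ler1n; lia. Qed.

Let kK : kap ^+ 2 = K%:R.
Proof. by rewrite sqr_sqrtr. Qed.

(** The price [pr] lies between [v (K + 2 tau kap)] and [v (K + 6 tau kap)], so a selected noise
    column loses at least [v tau kap]. A missed signal column was worth at least
    [xnorm2 / 2 - 7 v tau kap], and [xnorm2 >= 32 v tau kap] makes this at least
    [xnorm2 / 4 + v tau kap]. The labelling has to make up for both. *)
Lemma excess_large :
  theta = (K%:R + 4 * tau * kap) / n%:R -> 16 * tau ^+ 2 <= n%:R -> (K <= n)%N -> (s < p)%N ->
  (forall j, j \in J -> 32 * tau * kap * v <= xnorm2 j) ->
  v * (missed c.1.2 / v / 4 + #|symdiff c.1.2 J|%:R * (tau * kap)) <= excess c.1.1 c.1.2 y.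
Proof.
move=> thE n16 Kn sp sig.
have [tau1' v0' k1' kK'] := And4 tau1 v0 k1 kK.
have n0 : 0 < n%:R :> R by apply: lt_le_trans n16; rewrite mulr_gt0// exprn_gt0//; lra.
have nuE : nu ^+ 2 = n%:R by rewrite sqr_sqrtr// ltW.
have nu0 : 0 < nu by rewrite sqrtr_gt0.
have nu4 : 4 * tau <= nu by rewrite -(ler_pXn2r (n := 2)) ?nnegrE ?(ltW nu0)//; nra.
have kn : kap <= nu by rewrite ler_wsqrtr// ler_nat.
have [jn jnJ] : exists j, j \notin J.
  apply/existsP; rewrite -negb_forall; apply/negP => /forallP H.
  have : #|J| = p by rewrite -[RHS]card_ord; apply: eq_card => j; rewrite H.
  by lia.
have [j1 _ j1min] := @Order.TotalTheory.arg_minP _ _ _ jn xpredT (norm2 y) isT.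
pose pr := theta * norm2 y j1.
have [_ N1 _ _] := good j1; have [_ _ _ /(_ jnJ) N2] := good jn.
have N3 : norm2 y j1 < v * (n%:R + tau * nu) by apply: le_lt_trans N2; exact: j1min.
have tk : 0 < tau * kap by rewrite mulr_gt0//; lra.
have K4 : 0 < K%:R + 4 * tau * kap by have := ler0n R K; lra.
pose r := tau / nu.
have r4 : r <= 1 / 4 by rewrite ler_pdivrMr//; lra.
have r0 : 0 <= r by rewrite divr_ge0 ?ltW//; lra.
have rn : tau * nu = r * n%:R by rewrite -[X in _ = _ * X]nuE /r; field; rewrite gt_eqF.
have kr : K%:R * r <= tau * kap.
  rewrite /r mulrA ler_pdivrMr//.
  have -> : K%:R * tau = tau * kap * kap by rewrite -mulrA -expr2 kK mulrC.
  by rewrite ler_wpM2l// ltW.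
have prE : pr = (K%:R + 4 * tau * kap) * (norm2 y j1 / n%:R) by rewrite /pr thE; ring.
have M1 : v * (1 - r) <= norm2 y j1 / n%:R.
  rewrite ler_pdivlMr// (_ : _ * n%:R = v * (n%:R - r * n%:R)); last by ring.
  by rewrite -rn ltW.
have M2 : norm2 y j1 / n%:R <= v * (1 + r).
  rewrite ler_pdivrMr// (_ : _ * n%:R = v * (n%:R + r * n%:R)); last by ring.
  by rewrite -rn ltW.
have kr2 : r * (tau * kap) <= tau * kap / 4.
  have := ler_wpM2r (ltW tk) r4; lra.
have pr1 : v * (K%:R + 2 * tau * kap) <= pr.
  rewrite prE; apply: (@le_trans _ _ ((K%:R + 4 * tau * kap) * (v * (1 - r)))); last first.
    by rewrite ler_wpM2l// ltW.
  by rewrite mulrCA ler_wpM2l ?(ltW v0)//; lra.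
have pr2 : pr <= v * (K%:R + 6 * tau * kap).
  rewrite prE; apply: (@le_trans _ _ ((K%:R + 4 * tau * kap) * (v * (1 + r)))).
    by rewrite ler_wpM2l// ltW.
  by rewrite mulrCA ler_wpM2l ?(ltW v0)//; lra.
(* Moving the price column of [c] to the one of smallest norm can only raise the criterion, so both
   candidates are compared at the common price [pr]. *)
have h1 : crit theta (cand h J j1) y <= crit theta (cand c.1.1 c.1.2 j1) y.
  apply: le_trans (cmax (valid_truth j1 Js)) _; rewrite !critE /=.
  apply: ler_sum => j _; rewrite lerD2l lerN2 ler_wpM2l//; last exact: j1min.
  by rewrite thE divr_ge0// ltW.
move: h1; rewrite !critE /= -/pr => h1.
have : \sum_(j in J :\: c.1.2) (energy h y j - pr) - \sum_(j in c.1.2 :\: J) (energy h y j - pr)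
    <= excess c.1.1 c.1.2 y.
  rewrite -sum_sub_symdiff /excess lerBlDr -big_split /=.
  by apply: le_trans h1 _; apply: ler_sum => j _; rewrite addrA subrK.
apply: le_trans; rewrite card_symdiff natrD /missed.
have b1 : \sum_(j in J :\: c.1.2) (xnorm2 j / 4 + v * (tau * kap))
    <= \sum_(j in J :\: c.1.2) (energy h y j - pr).
  apply: ler_sum => j; rewrite inE => /andP[_ jJ].
  have [E1 _ _ _] := good j; have := sig j jJ; nra.
have b2 : \sum_(j in c.1.2 :\: J) (energy h y j - pr) <= \sum_(j in c.1.2 :\: J) - (v * (tau * kap)).
  apply: ler_sum => j; rewrite inE => /andP[jJ _].
  have [_ _ /(_ jJ) E1 _] := good j; nra.
move: b1 b2; rewrite big_split /= -mulr_suml !sum_constr.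
set a1 := \sum_(j in _) xnorm2 j; set a2 := \sum_(j in _) _; set a3 := \sum_(j in _) _.
set q1 := #|_|%:R; set q2 := #|_|%:R => b1 b2.
have -> : v * (a1 / v / 4 + (q2 + q1) * (tau * kap)) = a1 / 4 + (q1 + q2) * (v * (tau * kap)).
  by field; rewrite gt_eqF.
lra.
Qed.

(** At price zero up to [s] noise columns may be selected, worth at most [v (K + tau kap)] each, and
    every missed column adds a fluctuation [v tau kap]; [3 s tau K v] covers the total. *)
Lemma excess_small : theta = 0 ->
  v * (missed c.1.2 / v / 2 - 3 * s%:R * tau * K%:R) <= excess c.1.1 c.1.2 y.
Proof.
move=> th0.
have [tau1' v0' k1' kK'] := And4 tau1 v0 k1 kK.
have /andP[_ cs] := vc.
have kleK : kap <= K%:R by rewrite -[leRHS]kK expr2 ler_peMr// (le_trans ler01).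
have h1 : \sum_(j in J) energy h y j <= \sum_(j in c.1.2) energy c.1.1 y j.
  by have := cmax (valid_truth c.2 Js); rewrite th0 !crit0E.
have : \sum_(j in J :\: c.1.2) energy h y j - \sum_(j in c.1.2 :\: J) energy h y j
    <= excess c.1.1 c.1.2 y.
  by rewrite -sum_sub_symdiff /excess sumrB lerD2r.
apply: le_trans; rewrite /missed.
have b1 : \sum_(j in J :\: c.1.2) (xnorm2 j / 2 - v * (tau * kap))
    <= \sum_(j in J :\: c.1.2) energy h y j.
  apply: ler_sum => j; rewrite inE => /andP[_ jJ].
  have [E1 _ _ _] := good j; have : 0 <= v * K%:R by rewrite mulr_ge0// ltW.
  lra.
have b2 : \sum_(j in c.1.2 :\: J) energy h y j <= \sum_(j in c.1.2 :\: J) (v * (K%:R + tau * kap)).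
  apply: ler_sum => j; rewrite inE => /andP[jJ _].
  by have [_ _ /(_ jJ) E1 _] := good j; rewrite ltW.
move: b1 b2; rewrite big_split /= -mulr_suml !sum_constr.
set a1 := \sum_(j in _) xnorm2 j; set a2 := \sum_(j in _) _; set a3 := \sum_(j in _) _.
set q1 := #|_|%:R; set q2 := #|_|%:R => b1 b2.
have q1s : q1 <= s%:R by rewrite ler_nat (leq_trans _ Js)// subset_leq_card// finset.subsetDl.
have q2s : q2 <= s%:R by rewrite ler_nat (leq_trans _ cs)// subset_leq_card// finset.subsetDl.
have t0 : 0 <= v * (tau * kap) by rewrite !mulr_ge0 ?(ltW v0)//; lra.
have t1 : 0 <= v * (K%:R + tau * kap) by rewrite mulrDr addr_ge0// mulr_ge0 ?(ltW v0).
have e1 : q1 * (v * (tau * kap)) <= s%:R * (v * (tau * kap)) by rewrite ler_wpM2r.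
have e2 : q2 * (v * (K%:R + tau * kap)) <= s%:R * (v * (K%:R + tau * kap)) by rewrite ler_wpM2r.
have e3 : K%:R + 2 * (tau * kap) <= 3 * tau * K%:R.
  have : tau * kap <= tau * K%:R by rewrite ler_wpM2l//; lra.
  have : K%:R <= tau * K%:R by rewrite ler_peMl.
  lra.
have e4 : s%:R * (v * (K%:R + 2 * (tau * kap))) <= s%:R * (v * (3 * tau * K%:R)).
  by rewrite ler_wpM2l// ler_wpM2l// ltW.
have -> : v * (a1 / v / 2 - 3 * s%:R * tau * K%:R) = a1 / 2 - s%:R * (v * (3 * tau * K%:R)).
  by field; rewrite gt_eqF.
lra.
Qed.

(** At price zero no column has negative worth, so extending the selection of [c] to all columns
    does not lower its criterion. *)
Lemma excess_full : theta = 0 -> s = p -> 0 <= excess c.1.1 [set: 'I_p]%SET y.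
Proof.
move=> th0 sp; have fs : (#|[set: 'I_p]%SET| <= s)%N by rewrite cardsT card_ord sp.
have := cmax (valid_truth c.2 fs); rewrite th0 !crit0E /= /excess sumrB subr_ge0.
move=> h1; apply: le_trans h1 _; rewrite [leLHS]big_mkcond [leRHS]big_mkcond /=.
apply: ler_sum => j _; rewrite inE; case: ifP => // _.
exact: sym_idem_ge0 (sym_idem_projm _).
Qed.
End maximizer.
End selection.

(** * Arithmetic of the Chernoff exponent *)

Section exponents.
Context {R : realType}.
Implicit Types S gam L kap s n m q l t z w B tau : R.

(* The parameter of Chernoff's bound: the first term pays [8 L] for each wrongly
   selected column, the second one for each misclassified point. *)
Definition rate S gam L kap : R := (16 * kap)^-1 + 256 * gam * L / S.

(** Each summand of [rate] receives half of the variance budget [S / (16 gam)]. For [1 / (16 kap)]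
    this is the condition on [s kap / n]; for the summand proportional to [1 / S] it is the
    condition on [S ^+ 2]. The first condition keeps [l] below 1/8. *)
Lemma rate_bounds S gam L kap s n (l := rate S gam L kap) :
  0 < S -> 1 <= gam -> 1 <= kap -> 0 < L -> 0 < n -> 0 < s ->
  16 * 256 * gam * L <= S -> 96 * gam ^+ 2 * (s * kap / n) <= S ->
  32 * 48 * 256 * gam ^+ 3 * L * (s * kap ^+ 2 / n) <= S ^+ 2 ->
  [/\ 0 < l, l <= 1 / 8, (16 * kap)^-1 <= l,
      l * (48 * s * kap ^+ 2 * gam / n) <= S / (16 * gam) & 16 * L <= l * (S / (16 * gam))].
Proof.
move=> S0 gam1 kap1 L0 n0 s0 h1 h2 h3.
have g0 : 0 < gam by lra. have k0 : 0 < kap by lra.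
have Sn : S != 0 by rewrite gt_eqF. have gn : gam != 0 by rewrite gt_eqF.
have kn : kap != 0 by rewrite gt_eqF. have nn : n != 0 by rewrite gt_eqF.
have a0 : 0 < (16 * kap)^-1 by rewrite invr_gt0; lra.
have b0 : 0 < 256 * gam * L / S by apply: divr_gt0 => //; do 2 apply: mulr_gt0 => //.
have a1 : (16 * kap)^-1 <= 1 / 16 by rewrite mul1r lef_pV2 ?posrE//; lra.
have b1 : 256 * gam * L / S <= 1 / 16 by rewrite ler_pdivrMr//; lra.
rewrite /l /rate; split; [lra|lra|lra| |].
- rewrite [leLHS]mulrDl.
  have e1 : (16 * kap)^-1 * (48 * s * kap ^+ 2 * gam / n) <= S / (32 * gam).
    rewrite ler_pdivlMr ?mulr_gt0//.
    by rewrite (_ : _ * (32 * gam) = 96 * gam ^+ 2 * (s * kap / n)) //; field; rewrite nn kn.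
  have e2 : 256 * gam * L / S * (48 * s * kap ^+ 2 * gam / n) <= S / (32 * gam).
    rewrite ler_pdivlMr ?mulr_gt0//.
    rewrite (_ : _ * (32 * gam) = 32 * 48 * 256 * gam ^+ 3 * L * (s * kap ^+ 2 / n) / S).
      by rewrite ler_pdivrMr// -expr2.
    by field; rewrite nn Sn.
  have e3 : S / (16 * gam) = S / (32 * gam) + S / (32 * gam) by field.
  lra.
- rewrite [leRHS]mulrDl.
  have -> : 256 * gam * L / S * (S / (16 * gam)) = 16 * L by field; rewrite Sn gn.
  by rewrite lerDr mulr_ge0 ?divr_ge0 ?(ltW a0) ?(ltW S0)//; lra.
Qed.

(** Half of the gain [l S m / (8 gam)] absorbs the variance, the other half pays for the
    misclassified points, and [w] pays for the columns. The quantity [n / (kap^2 gam)] is the lower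
    bound on the size of a true block. *)
Lemma exponent_le S gam L kap s n l B m q t z w :
  0 < gam -> 0 < n -> 0 <= l -> 0 <= m -> 0 <= B <= s ->
  l * (48 * s * kap ^+ 2 * gam / n) <= S / (16 * gam) -> 16 * L <= l * (S / (16 * gam)) ->
  0 <= L ->
  S * m / (8 * gam) + w <= t + z / 2 -> 8 * L * q <= l * w ->
  4 * l ^+ 2 * B * (12 * m / (n / (kap ^+ 2 * gam))) - l * (t + z / 2) <= - (8 * L) * (m + q).
Proof.
move=> g0 n0 l0 m0 /andP[B0 Bs] h1 h2 L0 h3 h4.
have k20 := sqr_ge0 kap; move: (kap ^+ 2) k20 h1 => k2 k20 h1.
have gn : gam != 0 by rewrite gt_eqF. have nn : n != 0 by rewrite gt_eqF.
have e0 : 12 * m / (n / (k2 * gam)) = 12 * m * k2 * gam / n by rewrite invf_div; ring.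
have e1 : 4 * l ^+ 2 * B * (12 * m * k2 * gam / n) <= l * m * (S / (16 * gam)).
  apply: (@le_trans _ _ (l * m * (l * (48 * s * k2 * gam / n)))); last first.
    by rewrite ler_wpM2l// mulr_ge0.
  rewrite -subr_ge0 (_ : _ - _ = l ^+ 2 * m * 48 * k2 * gam / n * (s - B)); last by ring.
  by rewrite !mulr_ge0// ?subr_ge0// ?invr_ge0 ltW.
have e2 : l * (S * m / (8 * gam)) = l * m * (S / (16 * gam)) + m * (l * (S / (16 * gam))).
  by field.
have e3 := ler_wpM2l l0 h3; have e4 := ler_wpM2l m0 h2.
rewrite e0; rewrite mulrDr in e3; move: e1 e2 e3 e4 h4.
set a := l * (t + _); set b := 4 * _ * _ * _; set e := l * m * _; set f := m * (l * _).
set o := l * (S * m / _); set u := l * w.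
have := mulr_ge0 m0 L0; lra.
Qed.
End exponents.

(** * Union bound over the candidates *)

Section failure.
Context {R : realType} {d : measure_display} {Omega : measurableType d}.
Context (P : probability Omega R) {n p K : nat}.
Variables (Y : {RV P >-> n.-tuple (p.-tuple R)}) (X : 'M[R]_(n, p)) (sigma : R).
Variables (mu : 'M[R]_(K, p)) (h : {ffun 'I_n -> 'I_K}) (J : {set 'I_p}) (tau : R).
Hypotheses (sigma0 : 0 < sigma) (gY : gaussian_data P Y X sigma).
Hypotheses (XE : forall i j, X i j = mu (h i) j) (hsurj : forall k, exists i, h i = k).
Hypotheses (muJ : forall k j, j \notin J -> mu k j = 0).
Hypotheses (K0 : (0 < K)%N) (n0 : (0 < n)%N).

Let good w := good_columns X h J (sigma ^+ 2) tau (Y w).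

Lemma bad_columns_le :
  exists B : set Omega, [/\ measurable B, forall w, ~ B w -> good w &
    (P B <= (4 * p%:R * expR (1 / 16 - tau / 8))%:E)%E].
Proof.
pose Q (b : bool) : 'M[R]_n := if b then projm h else 1%:M.
pose D (b : bool) : R := if b then K%:R else n%:R.
have sQ b : sym_idem (Q b) by case: b; [exact: sym_idem_projm|exact: sym_idem1].
have trQ b : \tr (Q b) = D b by case: b; [exact: projm_trace|exact: mxtrace1].
have Q1 u : Q false *m u = u :> 'cV_n by exact: mul1mx.
have D1 b : 1 <= D b by case: b; rewrite ler1n.
pose q b w j : R := dot (data_col (Y w) j) (Q b *m data_col (Y w) j).
have mq b j : measurable_fun setT (q b ^~ j).
  exact: (measurableT_comp (measurable_data_quadratic j (Q b)) (measurable_funPT Y)).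
(* The first boolean chooses between lower and upper tail, the second between [P_h] and the
   identity. Upper tails concern the noise columns only. *)
pose B (i : bool * bool * 'I_p) : set Omega :=
  if i.1.1 then [set w | q i.1.2 w i.2 <= sigma ^+ 2 * (D i.1.2 - tau * Num.sqrt (D i.1.2))
        + dot (col i.2 X) (Q i.1.2 *m col i.2 X) / 2]
  else if i.2 \in J then set0
  else [set w | sigma ^+ 2 * (D i.1.2 + tau * Num.sqrt (D i.1.2)) <= q i.1.2 w i.2].
have mB i : measurable (B i).
  rewrite /B; case: i.1.1.
    set a := _ + _ / 2; rewrite (_ : [set _ | _] = q i.1.2 ^~ i.2 @^-1` `]-oo, a]).
      by rewrite -[X in measurable X]setTI; exact: mq.
    by apply/seteqP; split => w; rewrite /= in_itv.
  case: (i.2 \in J) => //.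
  set a := _ * _; rewrite (_ : [set _ | _] = q i.1.2 ^~ i.2 @^-1` `[a, +oo[).
    by rewrite -[X in measurable X]setTI; exact: mq.
  by apply/seteqP; split => w; rewrite /= in_itv /= andbT.
have x0 j : j \notin J -> col j X = 0.
  by move=> jJ; apply/matrixP => i k; rewrite !mxE XE muJ.
exists [set w | exists i, B i w]; split.
- rewrite (_ : [set _ | _] = \bigcup_(i in [set: bool * bool * 'I_p]) B i).
    exact: fin_bigcup_measurable.
  by apply/seteqP; split => [w [i Bi]|w [i _ Bi]]; exists i.
- move=> w nB j; have fx : projm h *m col j X = col j X.
    by apply: (projm_fixed (f := fun k => mu k j)) => i; rewrite mxE XE.
  split.
  + rewrite ltNge; apply/negP => le; apply: nB; exists (true, true, j).
    by rewrite /B /q /= fx.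
  + rewrite ltNge; apply/negP => le; apply: nB; exists (true, false, j).
    rewrite /B /= /q !Q1 (le_trans le)// lerDl divr_ge0// dot_ge0//.
  + move=> jJ; rewrite ltNge; apply/negP => le; apply: nB; exists (false, true, j).
    by rewrite /B /q /= (negbTE jJ).
  + move=> jJ; rewrite ltNge; apply/negP => le; apply: nB; exists (false, false, j).
    by rewrite /B /= (negbTE jJ) /= /q Q1.
- pose e := expR (1 / 16 - tau / 8) : R.
  have Be i : (P (B i) <= e%:E)%E.
    case: i => [[b1 b2] j]; rewrite /B /=; case: b1.
      exact: (idem_lower_tail sigma0 gY tau j (sQ b2) (trQ b2) (D1 b2)).
    case: ifPn => jJ; first by rewrite measure0 lee_fin expR_ge0.
    exact: (idem_upper_tail sigma0 gY tau (sQ b2) (trQ b2) (D1 b2) (x0 _ jJ)).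
  apply: le_trans (union_bound mB Be) _; rewrite lee_fin sumr_const.
  rewrite !card_prod card_bool card_ord -[leLHS]mulr_natl.
  by rewrite natrM.
Qed.

Definition residual (g : 'I_n -> 'I_K) (A : {set 'I_p}) : R :=
  \sum_(j in A) dot (col j X) ((1%:M - projm g) *m col j X).

Variables (s : nat) (theta S gam b l L : R) (t : {set 'I_p} -> R) (J0 : {set 'I_p}).
Variables (adm : pred {set 'I_p}) (g0 : 'I_n -> 'I_K).
Hypotheses (p0 : (0 < p)%N) (Js : (#|J| <= s)%N) (S0 : 0 <= S) (gam1 : 1 <= gam) (b0 : 0 < b).
Hypotheses (sep : forall k k', k != k' -> 2 * (sigma ^+ 2 * S) <= \sum_j (mu k j - mu k' j) ^+ 2).
Hypotheses (bal : forall k k', fsize h k <= gam * fsize h k' :> R) (hb : forall k, b <= fsize h k).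
Hypothesis (l8 : 0 <= l <= 1 / 8).

Hypothesis select : forall w (c : candidate n p K), good w -> valid s c ->
  (forall c' : candidate n p K, valid s c' -> crit theta c' (Y w) <= crit theta c (Y w)) ->
  exists2 A, adm A & sigma ^+ 2 * t A <= excess h c.1.1 A (Y w).

Let m g : R := (hamming g h)%:R.

Hypothesis expo : forall g A, adm A -> 1 <= m g ->
  S * m g <= 2 * gam * (residual g [set: 'I_p] / sigma ^+ 2) ->
  4 * l ^+ 2 * #|A|%:R * (12 * m g / b) - l * (t A + residual g A / sigma ^+ 2 / 2)
    <= - (8 * L) * (m g + #|symdiff A J0|%:R).

(** The admissible sets, the threshold [t] and the reference set [J0] are abstract so that all cases
    of the column price share one union bound: [select] is what maximality yields on the good event,
    [expo] what the Chernoff exponent has to satisfy. *)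
Lemma kmeans_failure :
  (P [set w | selection s g0 (comparisons K theta (Y w)) <> label_blocks h]
    <= (4 * p%:R * expR (1 / 16 - tau / 8)
       + ((1 + K.-1%:R * expR (- (8 * L))) ^+ n - 1) * (1 + expR (- (8 * L))) ^+ p)%:E)%E.
Proof.
have [B1 [mB1 goodB1 PB1]] := bad_columns_le.
have s2 : 0 < sigma ^+ 2 by rewrite exprn_gt0.
pose T : finType := ({ffun 'I_n -> 'I_K} * {set 'I_p})%type.
pose ok (i : T) := [/\ forall k, exists i', i.1 i' = k, i.1 != h, adm i.2 &
  S * m i.1 <= 2 * gam * (residual i.1 [set: 'I_p] / sigma ^+ 2)].
pose E (i : T) : set Omega := [set w | t i.2 * sigma ^+ 2 <= excess h i.1 i.2 (Y w)].
(* Pairs outside [ok] get the empty event. Those with a labelling other than [h] keep their weight,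
   so that the sum still factorizes. *)
pose B (i : T) : set Omega := if `[< ok i >] then E i else set0.
pose x := expR (- (8 * L)) : R.
have x0 : 0 < x := expR_gt0 _.
pose bnd (i : T) : R :=
  if i.1 == h then 0 else x ^+ hamming i.1 h * x ^+ #|symdiff i.2 J0|.
have mE i : measurable (E i).
  have mf : measurable_fun setT (fun w => excess h i.1 i.2 (Y w)).
    rewrite /excess; under eq_fun do rewrite big_mkcond; apply: measurable_sum => j.
    case: (j \in i.2) => //; apply: measurable_funB;
      exact: (measurableT_comp (measurable_data_quadratic j _) (measurable_funPT Y)).
  rewrite (_ : E i = (fun w => excess h i.1 i.2 (Y w)) @^-1` `[t i.2 * sigma ^+ 2, +oo[).
    by rewrite -[X in measurable X]setTI; exact: mf.
  by apply/seteqP; split => w; rewrite /= in_itv /= andbT.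
have mB i : measurable (B i) by rewrite /B; case: ifP.
have mge1 g : g != h -> 1 <= m g.
  move=> gh; rewrite ler1n; apply/card_gt0P.
  have /existsP[i gi] : [exists i, g i != h i].
    by rewrite -negb_forall; apply: contra gh => /forallP H; apply/eqP/ffunP => i; exact/eqP.
  by exists i; rewrite inE.
have PB i : (P (B i) <= (bnd i)%:E)%E.
  rewrite /B; case: asboolP => [[sg gh ai ci]|_]; last first.
    rewrite measure0 lee_fin /bnd; case: ifP => // _.
    by rewrite mulr_ge0 ?exprn_ge0// ltW.
  have V := projm_sub_frobenius sg hsurj b0 hb.
  apply: le_trans (projm_diff_tail sigma0 gY i.2 (t i.2) XE sg hsurj V l8) _.
  rewrite lee_fin /bnd (negbTE gh) -exprD /x -expRM_natl ler_expR.
  apply: le_trans (expo ai (mge1 _ gh) ci) _.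
  by rewrite natrD mulrC.
have sumB : \sum_i bnd i = ((1 + K.-1%:R * x) ^+ n - 1) * (1 + x) ^+ p.
  transitivity (\sum_(g : {ffun 'I_n -> 'I_K}) \sum_(A : {set 'I_p}) bnd (g, A)).
    by rewrite pair_bigA; apply: eq_bigr => -[].
  rewrite (eq_bigr (fun g => (if g == h then 0 else x ^+ hamming g h) * (1 + x) ^+ p)).
    rewrite -mulr_suml; congr (_ * _); rewrite -(sum_ffun_hamming h) [in RHS](bigD1 h)//=.
    rewrite (_ : hamming h h = 0)%N; last by apply: eq_card0 => i; rewrite !inE eqxx.
    rewrite expr0 addrC addrK (bigD1 h)//= eqxx add0r.
    by apply: eq_bigr => g /negbTE ->.
  move=> g _; rewrite /bnd /=; case: ifP => gh; first by rewrite mul0r big1.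
  by rewrite -mulr_sumr [X in _ * X](sum_set_symdiff J0 x) card_ord.
rewrite -/x -sumB.
have mB2 : measurable [set w | exists i, B i w].
  rewrite (_ : [set _ | _] = \bigcup_(i in [set: T]) B i); first exact: fin_bigcup_measurable.
  by apply/seteqP; split => [w [i Bi]|w [i _ Bi]]; exists i.
apply: (@le_trans _ _ (P (B1 `|` [set w | exists i, B i w]))); last first.
  by apply: le_trans (measureU2 P mB1 mB2) _; rewrite EFinD leeD// union_bound.
have mF : measurable [set w | selection s g0 (comparisons K theta (Y w)) <> label_blocks h].
  rewrite (_ : [set _ | _] = ~` ((fun w => (Y w, tt)) @^-1`
    [set x | kmeans s theta g0 x = label_blocks h])).
    apply: measurableC; rewrite -[X in measurable X]setTI.
    apply: (_ : measurable_fun setT (fun w => (Y w, tt))) => //; last exact: measurable_kmeans.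
    by apply: measurable_fun_pair => //; exact: measurable_funPT.
  by [].
apply: le_measure; rewrite ?inE//; first exact: measurableU.
move=> w /= neq; have [|nB1] := pselect (B1 w); [by left|right].
have gw := goodB1 w nB1.
have vh : valid s ((h, J, Ordinal p0) : candidate n p K) by exact: (valid_truth hsurj (Ordinal p0) Js).
have [c [vc cmax cE]] := kmeansP theta g0 (Y w, tt) (ex_intro (valid s) _ vh).
have [A admA At] := select gw vc cmax.
have D0 : 0 <= sigma ^+ 2 * S by rewrite mulr_ge0// ltW.
have [phi resphi] := residual_ge c.1.1 XE D0 sep.
have [q injq hq] := relabel c.1.1 phi bal gam1.
(* Relabelling changes neither the projection nor the blocks, so the failure is charged to a copy
   whose Hamming distance to [h] is controlled by the residual. *)
pose g : {ffun 'I_n -> 'I_K} := [ffun i => q (c.1.1 i)].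
have gE : (g : 'I_n -> 'I_K) = q \o c.1.1 by apply/funext => i; rewrite ffunE.
have projg : projm g = projm c.1.1 :> 'M[R]_n by rewrite gE projm_relabel.
exists (g, A); rewrite /B; case: asboolP => [_|[]]; last split => //=.
- rewrite /E /= mulrC (le_trans At)//; apply: ler_sum => j _.
  by rewrite /energy projg.
- have [q' qK q'K] := injF_bij injq.
  move=> k; have /andP[/forallP /(_ (q' k)) /existsP[i /eqP ci] _] := vc.
  by exists i; rewrite ffunE ci q'K.
- apply/eqP => gh; apply: neq; apply: etrans cE _; rewrite -(label_blocks_comp c.1.1 injq) -gE gh//.
- set N := #|_|%:R in resphi hq; set r := residual g [set: 'I_p].
  have r1 : sigma ^+ 2 * S * N <= r.
    rewrite /r /residual projg; apply: le_trans resphi _.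
    by rewrite [leRHS]big_mkcond; apply: ler_sum => j _; rewrite inE.
  have r0 : 0 <= r.
    apply: sumr_ge0 => j _; rewrite mulmxBl mul1mx dotBr subr_ge0.
    exact: sym_idem_le (sym_idem_projm _).
  rewrite mulrA ler_pdivlMr// /m gE.
  apply: (@le_trans _ _ ((1 + gam) * (sigma ^+ 2 * S * N))).
    rewrite (_ : _ * sigma ^+ 2 = sigma ^+ 2 * S * (hamming (q \o c.1.1) h)%:R); last by ring.
    by rewrite mulrCA ler_wpM2l.
  have := gam1 => g1.
  have : (1 + gam) * (sigma ^+ 2 * S * N) <= (1 + gam) * r by rewrite ler_wpM2l//; lra.
  have : gam * r >= r by rewrite ler_peMl.
  lra.
Qed.
End failure.

Section regimes.
Context {R : realType}.

(** The residual of a missed column is at most its squared norm, and a column outside [J] has no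
    signal. *)
Lemma residual_missed n p K (X : 'M[R]_(n, p)) (mu : 'M[R]_(K, p)) (h g : 'I_n -> 'I_K)
    (J A : {set 'I_p}) :
  (forall i j, X i j = mu (h i) j) -> (forall k j, j \notin J -> mu k j = 0) ->
  residual X g [set: 'I_p]%SET <= residual X g A + missed X J A.
Proof.
move=> XE muJ; rewrite /residual /missed !(big_mkcond (fun j => j \in _)) -big_split /=.
apply: ler_sum => j _; rewrite !inE.
have le1 : dot (col j X) ((1%:M - projm g) *m col j X) <= xnorm2 X j.
  rewrite mulmxBl mul1mx dotBr gerBl; exact: sym_idem_ge0 (sym_idem_projm _).
have [jA|jA] /= := boolP (j \in A); first by rewrite addr0.
have [jJ|jJ] := boolP (j \in J); first by rewrite add0r.
rewrite addr0 (_ : col j X = 0) ?mulmx0 ?dot0r//.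
by apply/matrixP => i k; rewrite !mxE XE muJ.
Qed.

Lemma residual_ge0 n p K (X : 'M[R]_(n, p)) (g : 'I_n -> 'I_K) (A : {set 'I_p}) :
  0 <= residual X g A.
Proof.
apply: sumr_ge0 => j _; rewrite mulmxBl mul1mx dotBr subr_ge0.
exact: sym_idem_le (sym_idem_projm _).
Qed.

Lemma ln_ge_half (N : R) : 2 <= N -> 1 / 2 <= ln N.
Proof.
move=> N2; have N0 : 0 < N by lra.
have i0 : 0 < N^-1 by rewrite invr_gt0.
have : N^-1 <= 2^-1 by rewrite lef_pV2 ?posrE.
have : ln (1 + (N^-1 - 1)) <= N^-1 - 1 by apply: le_ln1Dx; lra.
rewrite addrCA subrr addr0 lnV ?posrE//; lra.
Qed.

(** With [N = n p] the weight [x] is [N^-8]. Since [tau = 128 L], the tail of a bad column is below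
    [x] too, and every sum is bounded by a multiple of [y = N^-6]. *)
Lemma failure_bound n p K (L tau : R) : (1 < K <= n)%N -> (0 < p)%N ->
  L = ln (n * p)%:R -> tau = 128 * L ->
  4 * p%:R * expR (1 / 16 - tau / 8)
    + ((1 + K.-1%:R * expR (- (8 * L))) ^+ n - 1) * (1 + expR (- (8 * L))) ^+ p
  <= 4 / n%:R ^+ 2.
Proof.
move=> /andP[K1 Kn] p0 LE tauE.
pose N : R := (n * p)%:R; set x := expR (- (8 * L)).
have N2 : 2 <= N by rewrite ler_nat; nia.
have L2 : 1 / 2 <= L by rewrite LE ln_ge_half.
have x0 : 0 < x := expR_gt0 _.
have xN : N ^+ 4 * (N ^+ 4 * x) = 1.
  rewrite mulrA -exprD /x LE -/N; set lN := ln N.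
  have -> : N ^+ 8 = expR (8 * lN).
    by rewrite expRM_natl lnK// posrE; lra.
  by rewrite -expRD subrr expR0.
have N4 : 16 <= N ^+ 4.
  rewrite (_ : 16 = 2 ^+ 4); last by ring.
  by rewrite lerXn2r ?nnegrE//; lra.
have h1 : N ^+ 4 * x <= 1 / 16.
  have : 0 <= N ^+ 4 * x by rewrite mulr_ge0 ?exprn_ge0 ?ltW//; lra.
  set u := N ^+ 4 * x in xN *; nra.
pose y := N ^+ 2 * x.
have nN : n%:R <= N by rewrite ler_nat; nia.
have pN : p%:R <= N by rewrite ler_nat; nia.
have KN : K.-1%:R <= n%:R :> R by rewrite ler_nat; lia.
have n0 : 1 <= n%:R :> R by rewrite ler1n; lia.
have y0 : 0 < y by rewrite mulr_gt0// exprn_gt0//; lra.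
have yn : n%:R ^+ 2 * y <= 1 / 16.
  apply: le_trans h1; rewrite (_ : N ^+ 4 * x = N ^+ 2 * y); last by rewrite /y mulrA -exprD.
  rewrite ler_wpM2r ?(ltW y0)// lerXn2r ?nnegrE//; lra.
have y16 : y <= 1 / 16.
  by apply: le_trans yn; rewrite ler_peMl ?(ltW y0)// exprn_ege1.
have xNy : N * x <= y.
  by rewrite /y expr2 -mulrA ler_peMl// ?mulr_ge0 ?(ltW x0)//; lra.
have px : p%:R * x <= y by apply: le_trans xNy; rewrite ler_wpM2r// ltW.
have nKx : n%:R * (K.-1%:R * x) <= y.
  rewrite mulrA /y ler_wpM2r ?(ltW x0)// expr2 ler_pM//.
  exact: le_trans KN nN.
have e1 : expR (1 / 16 - tau / 8) <= x by rewrite ler_expR tauE; lra.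
have e2 : (1 + K.-1%:R * x) ^+ n <= 1 + 2 * (n%:R * (K.-1%:R * x)).
  by apply: expr1D_le; [rewrite mulr_ge0// ltW|lra].
have e3 : (1 + x) ^+ p <= 1 + 2 * (p%:R * x).
  by apply: expr1D_le; [exact: ltW|lra].
have e4 : 4 * p%:R * expR (1 / 16 - tau / 8) <= 4 * (p%:R * x).
  by rewrite -mulrA ler_wpM2l// ler_wpM2l.
have e5 : 1 <= (1 + K.-1%:R * x) ^+ n.
  by rewrite exprn_ege1// lerDl mulr_ge0// ltW.
have e6 : ((1 + K.-1%:R * x) ^+ n - 1) * (1 + x) ^+ p <= 2 * y * 2.
  apply: ler_pM; [lra| |lra|lra].
  by rewrite exprn_ge0//; lra.
rewrite ler_pdivlMr ?exprn_gt0//; last by lra.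
have n20 : 0 <= n%:R ^+ 2 :> R by rewrite sqr_ge0.
have : (4 * y + 2 * y * 2) * n%:R ^+ 2 <= 4 by lra.
apply: le_trans; rewrite ler_wpM2r//; lra.
Qed.

(** As [gam] and [eta] are known only through [hh], the single constant [M] has to dominate every
    requirement. The cube of [hh] matches the [gam ^+ 3] of [rate_bounds], whose condition on
    [S ^+ 2] follows from the square-root term by squaring. *)
Lemma regime (S gam eta hh tau kap s n : R) (M := 64 * 128 * hh ^+ 3 * tau ^+ 6)
    (l := rate S gam (tau / 128) kap) :
  1 <= gam -> 1 <= eta -> gam <= hh -> eta <= hh -> 1 <= tau -> 1 <= kap -> 0 < s -> 0 < n ->
  M * (1 + Num.sqrt (s * kap ^+ 2 / n) + s * kap / n) <= S ->
  [/\ 0 < S, 0 < l, l <= 1 / 8, (16 * kap)^-1 <= l &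
      l * (48 * s * kap ^+ 2 * gam / n) <= S / (16 * gam)] /\
  [/\ 16 * (tau / 128) <= l * (S / (16 * gam)),
      64 * (gam * eta) * tau * (s * kap / n) <= S &
      64 * 128 * gam * tau ^+ 4 * (s * kap / n) <= S].
Proof.
move=> g1 e1 ghh ehh tau1 k1 s0 n0 SM.
have hh1 : 1 <= hh by exact: le_trans ghh.
have hh0 : 0 < hh := lt_le_trans ltr01 hh1.
have tau0 : 0 < tau := lt_le_trans ltr01 tau1.
have g0 : 0 < gam := lt_le_trans ltr01 g1.
have e0 : 0 < eta := lt_le_trans ltr01 e1.
have k0 : 0 < kap := lt_le_trans ltr01 k1.
have M0 : 0 < M by do 2 (apply: mulr_gt0; last exact: exprn_gt0).
set a1 := s * kap / n in SM *; pose a2 := s * kap ^+ 2 / n.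
have a10 : 0 < a1 by apply: divr_gt0 => //; exact: mulr_gt0.
have a20 : 0 < a2 by apply: divr_gt0 => //; apply: mulr_gt0 => //; exact: exprn_gt0.
have r0 : 0 < Num.sqrt a2 by rewrite sqrtr_gt0.
have [SM1 SM2 SM3] : [/\ M <= S, M * a1 <= S & M * Num.sqrt a2 <= S].
  move: SM; rewrite -/a2 !mulrDr mulr1.
  have := mulr_gt0 M0 r0; have := mulr_gt0 M0 a10; move: (M * a1) (M * Num.sqrt a2).
  clear -M0 => b1 b2 *; split; lra.
have S0 : 0 < S := lt_le_trans M0 SM1.
have SM4 : M ^+ 2 * a2 <= S ^+ 2.
  rewrite -(sqr_sqrtr (ltW a20)) -exprMn lerXn2r// nnegrE ?(ltW S0)//.
  exact: ltW (mulr_gt0 M0 r0).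
have hhp (i j : nat) (c x : R) : (i <= 3)%N -> (j <= 6)%N -> 0 <= x -> x <= hh ^+ i ->
    c <= 64 * 128 -> c * (x * tau ^+ j) <= M.
  move=> i3 j6 x0 xh c1; rewrite /M -[leRHS]mulrA.
  apply: (@le_trans _ _ (64 * 128 * (x * tau ^+ j))).
    by rewrite ler_wpM2r// mulr_ge0// exprn_ge0 ?(ltW tau0).
  rewrite ler_wpM2l//; apply: (@le_trans _ _ (hh ^+ i * tau ^+ j)).
    by rewrite ler_wpM2r// exprn_ge0 ?(ltW tau0).
  apply: ler_pM; [exact: exprn_ge0 (ltW hh0)|exact: exprn_ge0 (ltW tau0)| |].
    exact: (ler_weXn2l hh1).
  exact: (ler_weXn2l tau1).
have gX i : gam ^+ i <= hh ^+ i by rewrite lerXn2r ?nnegrE ?(ltW g0) ?(ltW hh0).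
have gX0 i : 0 <= gam ^+ i by rewrite exprn_ge0 ?(ltW g0).
have hM1 : 32 * (gam * tau) <= M by apply: (hhp 1 1) => //; [exact: ltW|clear; lra].
have hM2 : 96 * gam ^+ 2 <= M.
  by rewrite -[leLHS]mulr1 -mulrA; apply: (hhp 2 0) => //; clear; lra.
have hM3 : 32 * 48 * 2 * (gam ^+ 3 * tau) <= M by apply: (hhp 3 1) => //; clear; lra.
have hM4 : 64 * ((gam * eta) * tau) <= M.
  apply: (hhp 2 1) => //; [exact: ltW (mulr_gt0 g0 e0)| |clear; lra].
  by rewrite expr2 ler_pM// ltW.
have hM5 : 64 * 128 * (gam * tau ^+ 4) <= M by apply: (hhp 1 4) => //; exact: ltW.
have M1 : 1 <= M.
  by rewrite -[leLHS](mul1r 1) -[in leLHS](mulr1 1); apply: (hhp 0 0) => //; clear; lra.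
have L0 : 0 < tau / 128 by rewrite divr_gt0.
have c1 : 16 * 256 * gam * (tau / 128) <= S.
  by apply: le_trans SM1; apply: le_trans hM1; rewrite le_eqVlt; apply/orP; left; apply/eqP; field.
have c2 : 96 * gam ^+ 2 * (s * kap / n) <= S.
  by apply: le_trans SM2; rewrite ler_wpM2r ?(ltW a10).
have c3 : 32 * 48 * 256 * gam ^+ 3 * (tau / 128) * (s * kap ^+ 2 / n) <= S ^+ 2.
  apply: le_trans SM4; rewrite ler_wpM2r ?(ltW a20)//.
  apply: (@le_trans _ _ M); last by rewrite expr2 ler_peMl// ltW.
  by apply: le_trans hM3; rewrite le_eqVlt; apply/orP; left; apply/eqP; field.
have [l0 l8 lk lB lC] := rate_bounds S0 g1 k1 L0 n0 s0 c1 c2 c3; split; split => //.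
- by apply: le_trans SM2; rewrite ler_wpM2r ?(ltW a10)// -mulrA.
- by apply: le_trans SM2; rewrite ler_wpM2r ?(ltW a10)// -mulrA.
Qed.

(** For [n <= 16 tau^2] the term [s kap / n] is at least [s kap / (16 tau^2)], so [S] dominates
    [tau^2 s kap]. The loss of [excess_small] is at most [12 tau^2 s kap] because [kap <= 4 tau],
    and the remainder pays for the at most [2 s] wrong columns. *)
Lemma small_sample (S gam tau kap s l m q n : R) : 0 < gam -> 1 <= tau -> 1 <= kap ->
  0 < s -> 0 < n -> 1 <= m -> q <= 2 * s -> (16 * kap)^-1 <= l ->
  kap <= 4 * tau -> n <= 16 * tau ^+ 2 -> 64 * 128 * gam * tau ^+ 4 * (s * kap / n) <= S ->
  8 * (tau / 128) * q <= l * (S * m / (8 * gam) - 3 * s * tau * kap ^+ 2).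
Proof.
move=> g0 tau1 k1 s0 n0 m1 qs lk k4 n16 hS.
have tau0 : 0 < tau := lt_le_trans ltr01 tau1.
have k0 : 0 < kap := lt_le_trans ltr01 k1.
have sk0 : 0 < s * kap by exact: mulr_gt0.
have h1 : 64 * 8 * gam * tau ^+ 2 * (s * kap) <= S.
  apply: le_trans hS; rewrite [leRHS]mulrA ler_pdivlMr//.
  rewrite (_ : 64 * 128 * gam * tau ^+ 4 * (s * kap) =
    64 * 8 * gam * tau ^+ 2 * (s * kap) * (16 * tau ^+ 2)); last by ring.
  by rewrite ler_wpM2l// ?mulr_ge0 ?exprn_ge0 ?(ltW g0) ?(ltW tau0) ?(ltW s0) ?(ltW k0).
have h2 : 64 * tau ^+ 2 * (s * kap) <= S * m / (8 * gam).
  rewrite ler_pdivlMr ?mulr_gt0//; apply: (@le_trans _ _ S).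
    by rewrite (_ : _ * (8 * gam) = 64 * 8 * gam * tau ^+ 2 * (s * kap))//; ring.
  rewrite ler_peMr//; apply: le_trans h1.
  by rewrite !mulr_ge0 ?exprn_ge0 ?(ltW g0) ?(ltW tau0) ?(ltW s0) ?(ltW k0).
have h3 : 3 * s * tau * kap ^+ 2 <= 12 * tau ^+ 2 * (s * kap).
  rewrite (_ : 3 * s * tau * kap ^+ 2 = 3 * tau * (s * kap) * kap); last by ring.
  rewrite (_ : 12 * _ * _ = 3 * tau * (s * kap) * (4 * tau)); last by ring.
  by rewrite ler_wpM2l// mulr_ge0 ?(ltW sk0)// mulr_ge0// ltW.
have h4 : 2 * tau * (s * kap) <= S * m / (8 * gam) - 3 * s * tau * kap ^+ 2.
  have : tau * (s * kap) <= tau ^+ 2 * (s * kap) by rewrite ler_wpM2r ?(ltW sk0)// expr2 ler_peMl// ltW.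
  have : 0 <= tau ^+ 2 * (s * kap) by rewrite mulr_ge0 ?sqr_ge0 ?(ltW sk0).
  move: h2 h3; rewrite -!(mulrA _ _ (s * kap)).
  move: (tau ^+ 2 * (s * kap)) (tau * (s * kap)) (S * m / _) (3 * s * tau * _).
  by clear => *; lra.
have l0 : 0 <= (16 * kap)^-1 by rewrite invr_ge0 mulr_ge0// ltW.
apply: (@le_trans _ _ ((16 * kap)^-1 * (2 * tau * (s * kap)))); last first.
  apply: ler_pM => //; by rewrite mulr_ge0 ?(ltW sk0)// mulr_ge0// ltW.
rewrite [leRHS](_ : _ = tau / 16 * (2 * s)); last by field; rewrite gt_eqF.
rewrite (_ : 8 * (tau / 128) = tau / 16); last by field.
by rewrite ler_wpM2l// divr_ge0// ltW.
Qed.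
End regimes.

(** * The three cases of the column price *)

Section success.
Context {R : realType}.

(* When [s = p] there may be no column of pure noise from which to estimate
   [sigma], but all columns can be kept. When [n] is at most polylogarithmic,
   the smallest of [p] column norms may be far below [sqrt n sigma], but
   [Delta^2] is then so large compared to [s] that no price is needed. *)
Definition tau_of (n p : nat) : R := 128 * ln (n * p)%:R.

Definition column_price (n p K s : nat) : R :=
  if (s == p) || (n%:R < 16 * tau_of n p ^+ 2) then 0
  else (K%:R + 4 * tau_of n p * Num.sqrt K%:R) / n%:R.

Lemma kmeans_success d (Omega : measurableType d) (P : probability Omega R) (n p K s : nat)
    (Y : {RV P >-> n.-tuple (p.-tuple R)}) (X : 'M[R]_(n, p)) (sigma : R)
    (mu : 'M[R]_(K, p)) (h : {ffun 'I_n -> 'I_K}) (J : {set 'I_p}) (S gam eta hh : R) g0 :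
  (1 < K <= n)%N -> (0 < s <= p)%N -> 0 < sigma -> gaussian_data P Y X sigma ->
  (forall i j, X i j = mu (h i) j) -> (forall k, exists i, h i = k) ->
  (forall k j, j \notin J -> mu k j = 0) -> (#|J| <= s)%N ->
  (forall k k', k != k' -> 2 * (sigma ^+ 2 * S) <= \sum_j (mu k j - mu k' j) ^+ 2) ->
  1 <= gam -> 1 <= eta -> gam <= hh -> eta <= hh ->
  (forall k k', fsize h k <= gam * fsize h k' :> R) -> homogeneous X J eta ->
  64 * 128 * hh ^+ 3 * tau_of n p ^+ 6 *
    (1 + Num.sqrt ((s * K)%:R / n%:R) + s%:R * Num.sqrt K%:R / n%:R) <= S ->
  (P [set w | selection s g0 (comparisons K (column_price n p K s) (Y w)) <> label_blocks h]
    <= (4 / n%:R ^+ 2)%:E)%E.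
Proof.
move=> Kn2 /andP[s0 sp] sigma0 gY XE hs muJ Js sep g1 e1 ghh ehh bal hom SM.
have /andP[K1 Kn] := Kn2.
have [K0 n0 p0] : [/\ 0 < K, 0 < n & 0 < p]%N by split; lia.
set tau := tau_of n p in SM *; pose L : R := ln (n * p)%:R.
have tauL : tau / 128 = L by rewrite /tau /tau_of mulrC mulKf.
have L2 : 1 / 2 <= L by rewrite ln_ge_half// ler_nat; nia.
have tau1 : 1 <= tau by move: L2; rewrite -tauL; clear; lra.
have nR : 0 < n%:R :> R by rewrite ltr0n.
have sR : 0 < s%:R :> R by rewrite ltr0n.
have v0 : 0 < sigma ^+ 2 by rewrite exprn_gt0.
set kap : R := Num.sqrt K%:R in SM *.
have kK : K%:R = kap ^+ 2 by rewrite sqr_sqrtr.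
have k1 : 1 <= kap by rewrite -[leLHS]sqrtr1 ler_wsqrtr// ler1n.
have k0 : 0 < kap := lt_le_trans ltr01 k1.
have gam0 : 0 < gam := lt_le_trans ltr01 g1.
have eta0 : 0 < eta := lt_le_trans ltr01 e1.
have tau0 : 0 < tau := lt_le_trans ltr01 tau1.
rewrite natrM kK in SM.
have [[S0 l0 l8 lk lB] [lC SM4 SM5]] := regime g1 e1 ghh ehh tau1 k1 sR nR SM.
set l := rate _ _ _ _ in l0 l8 lk lB lC; rewrite tauL in lC.
(* The 64 of [SM4], halved in [signal_column_ge], gives the 32 required by [excess_large]. *)
have sig j : j \in J -> 32 * tau * kap * sigma ^+ 2 <= xnorm2 X j.
  move=> jJ; have D0 : 0 <= sigma ^+ 2 * S by rewrite mulr_ge0// ltW.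
  have := signal_column_ge K1 gam0 D0 XE muJ Js sep bal (ltW eta0) hom jJ.
  rewrite -/(xnorm2 X j) => low.
  have se0 : 0 < s%:R * eta by exact: mulr_gt0.
  rewrite -(ler_pM2l se0); apply: le_trans low.
  rewrite ler_pdivlMr ?mulr_gt0//.
  rewrite [leRHS]mulrA; apply: le_trans (ler_wpM2l (ltW (mulr_gt0 nR v0)) SM4).
  rewrite le_eqVlt; apply/orP; left; apply/eqP.
  by clear -nR; field; rewrite gt_eqF.
(* Common end of the three cases. Each one supplies its admissible sets, threshold and reference
   set, and exhibits the surplus [w] that pays for wrong columns. *)
have reduce (theta : R) (adm : pred {set 'I_p}) (t : {set 'I_p} -> R) (J0 : {set 'I_p}) :
    (forall A, adm A -> (#|A| <= s)%N) ->
    (forall w (c : candidate n p K), good_columns X h J (sigma ^+ 2) tau (Y w) -> valid s c ->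
      (forall c' : candidate n p K, valid s c' -> crit theta c' (Y w) <= crit theta c (Y w)) ->
      exists2 A, adm A & sigma ^+ 2 * t A <= excess h c.1.1 A (Y w)) ->
    (forall g A, adm A -> 1 <= (hamming g h)%:R :> R ->
      S * (hamming g h)%:R / (2 * gam) <= residual X g [set: 'I_p]%SET / sigma ^+ 2 ->
      exists2 w, S * (hamming g h)%:R / (8 * gam) + w <= t A + residual X g A / sigma ^+ 2 / 2
        & 8 * L * #|symdiff A J0|%:R <= l * w) ->
    (P [set w | selection s g0 (comparisons K theta (Y w)) <> label_blocks h]
      <= (4 / n%:R ^+ 2)%:E)%E.
  move=> admS select expo.
  have b0 : 0 < n%:R / (kap ^+ 2 * gam).
    by apply: divr_gt0 => //; apply: mulr_gt0 => //; exact: exprn_gt0.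
  have hb k : n%:R / (kap ^+ 2 * gam) <= fsize h k.
    by rewrite -kK; exact: balanced_fsize_ge.
  have l08 : 0 <= l <= 1 / 8 by rewrite l8 ltW.
  apply: le_trans (kmeans_failure (L := L) (J0 := J0) sigma0 gY XE hs muJ K0 n0 g0 p0 Js (ltW S0) g1 b0
    sep bal hb l08 select _) _.
    move=> g A aA m1 cnd; have [|w hw1 hw2] := expo g A aA m1.
      by rewrite ler_pdivrMr ?mulr_gt0// [leRHS]mulrC.
    apply: (exponent_le gam0 nR (ltW l0) _ _ lB lC _ hw1 hw2).
    - exact: le_trans ler01 m1.
    - by rewrite ler0n ler_nat admS.
    - by apply: le_trans L2; clear; lra.
  by rewrite lee_fin; apply: failure_bound.
have z0 (g : 'I_n -> 'I_K) A : 0 <= residual X g A / sigma ^+ 2.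
  by apply: divr_ge0 (ltW v0); exact: residual_ge0.
have zsum (g : 'I_n -> 'I_K) A : residual X g [set: 'I_p]%SET / sigma ^+ 2 <=
    residual X g A / sigma ^+ 2 + missed X J A / sigma ^+ 2.
  have iv0 : 0 <= (sigma ^+ 2)^-1 by rewrite invr_ge0 (ltW v0).
  rewrite -mulrDl; apply: (ler_wpM2r iv0).
  exact: residual_missed XE muJ.
(* Only a quarter of the guaranteed residual is spent, because [excess_large] retains only a quarter
   of the missed energy. *)
have g8 m : S * m / (8 * gam) = S * m / (2 * gam) / 4.
  by clear -gam0; field; rewrite gt_eqF.
rewrite /column_price -/tau; have [sp'|sp'] /= := eqVneq s p.
  (* All columns are kept and the reference set is full, so no column is wrong and [w = 0]
     suffices. *)
  apply: (reduce 0 (pred1 [set: 'I_p]%SET) (fun=> 0) [set: 'I_p]%SET).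
  - by move=> A /eqP ->; rewrite cardsT card_ord sp'.
  - move=> w c _ vc cmax; exists [set: 'I_p]%SET; rewrite /= ?eqxx// mulr0.
    exact: (excess_full hs cmax).
  - move=> g A /eqP -> m1 cnd; exists 0.
      rewrite g8; have := z0 g [set: 'I_p]%SET; move: cnd.
      by move: (_ / (2 * gam)) (_ / sigma ^+ 2); clear => x y *; lra.
    by rewrite card_symdiff finset.setDv cards0 !mulr0.
have sp1 : (s < p)%N by rewrite ltn_neqAle sp' sp.
case: ltP => n16.
  have k4 : kap <= 4 * tau.
    have t40 : 0 <= 4 * tau by apply: mulr_ge0 (ltW tau0).
    rewrite -(ler_pXn2r (n := 2)) ?nnegrE ?(ltW k0) ?t40//.
    rewrite -kK exprMn (_ : 4 ^+ 2 = 16); last by clear; ring.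
    by apply: le_trans (ltW n16); rewrite ler_nat.
  apply: (reduce 0 (fun A => #|A| <= s)%N
    (fun A => missed X J A / sigma ^+ 2 / 2 - 3 * s%:R * tau * K%:R) J) => //.
  - move=> w c gw vc cmax; exists c.1.2; first by have /andP[] := vc.
    exact: (excess_small hs Js gw vc cmax).
  - move=> g A As m1 cnd; set m := (hamming g h)%:R in m1 cnd *.
    exists (S * m / (8 * gam) - 3 * s%:R * tau * K%:R).
      rewrite g8; have := zsum g A; move: cnd; move: (3 * _ * _ * _) (_ / (2 * gam)).
      move: (residual X g [set: 'I_p]%SET / _) (residual X g A / _) (missed X J A / _).
      by clear => *; lra.
    rewrite kK -tauL; apply: (small_sample gam0 tau1 k1 sR nR m1 _ lk k4 (ltW n16) SM5).
    rewrite card_symdiff natrD mulr_natl; apply: lerD; rewrite ler_nat.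
      by apply: leq_trans As; rewrite subset_leq_card// finset.subsetDl.
    by apply: leq_trans Js; rewrite subset_leq_card// finset.subsetDl.
apply: (reduce _ (fun A => #|A| <= s)%N
  (fun A => missed X J A / sigma ^+ 2 / 4 + #|symdiff A J|%:R * (tau * kap)) J) => //.
- move=> w c gw vc cmax; exists c.1.2; first by have /andP[] := vc.
  exact: (excess_large hs Js gw vc cmax).
- move=> g A As m1 cnd; exists (#|symdiff A J|%:R * (tau * kap)).
    rewrite g8; have := zsum g A; have := z0 g A; move: cnd; move: (_ * (tau * kap)) (_ / (2 * gam)).
    move: (residual X g [set: 'I_p]%SET / _) (residual X g A / _) (missed X J A / _).
    by clear => *; lra.
  rewrite mulrCA mulrC ler_wpM2l//.
  (* The bound [l >= 1 / (16 kap)] and [tau = 128 L] give exactly [8 L] per wrong column. *)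
  apply: (@le_trans _ _ ((16 * kap)^-1 * (tau * kap))).
    rewrite -tauL le_eqVlt; apply/orP; left; apply/eqP.
    by clear -k0; field; rewrite gt_eqF.
  by rewrite ler_wpM2r// mulr_ge0// ltW.
Qed.
End success.

Section estimator.
Context {R : realType} {n p K : nat} (s : nat) (hK : (1 < K <= n)%N).

Lemma labels_gt0 : (0 < K)%N.
Proof. by case/andP: hK => /ltnW. Qed.

Definition default_labelling (i : 'I_n) : 'I_K := insubd (Ordinal labels_gt0) (val i).

Lemma default_labelling_surj k : exists i, default_labelling i = k.
Proof.
have Kn : (K <= n)%N by case/andP: hK.
exists (widen_ord Kn k); apply/val_inj.
by rewrite /default_labelling val_insubd /= ltn_ord.
Qed.

Definition sparse_kmeans : estimator R n p K :=
  @Estimator R n p K _ unit (dirac tt) (kmeans s (column_price n p K s) default_labelling)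
    (measurable_kmeans s _ _) (fun x => kmeans_partition s _ x default_labelling_surj).
End estimator.

(* The estimator may depend on n, p, K and s only: it knows neither sigma, mu,
   J, G, nor a, eta, gamma. The bound K <= n holds in the model, because the K
   groups are nonempty. *)
Theorem corollary4p7 (R : realType) :
  exists Ghat : forall n p K s : nat, (1 < K <= n)%N -> estimator R n p K,
  forall a : R, 0 < a ->
  exists C C' : R, [/\ 0 < C, 0 < C' &
  forall (n p K s : nat) (hK : (1 < K <= n)%N)
    (d : measure_display) (Omega : measurableType d) (P : probability Omega R)
    (Y : {RV P >-> n.-tuple (p.-tuple R)})
    (U : {RV P >-> aux (Ghat n p K s hK)})
    (sigma : R) (J : {set 'I_p}) (mu : 'M[R]_(K, p))
    (G : 'I_K -> {set 'I_n}) (eta gamma : R),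
    (0 < s <= p)%N ->
    0 < sigma ->
    sparse_clustering_model s Y sigma J mu G ->
    (forall A, measurable A ->
       distribution P U A = aux_law (Ghat n p K s hK) A) ->
    independent2 P Y U ->
    1 <= eta -> 1 <= gamma ->
    homogeneous (mean_matrix mu G) J eta ->
    balanced G gamma ->
    eta <= a * ln (n * p)%:R `^ a ->
    gamma <= a * ln (n * p)%:R `^ a ->
    C * ln (n * p)%:R `^ C' *
      (1 + Num.sqrt ((s * K)%:R / n%:R) + s%:R * Num.sqrt K%:R / n%:R)
      <= separation2 mu sigma ->
    ((1 - 4 / n%:R ^+ 2)%:E
      <= P [set w | Ghat n p K s hK (Y w, U w) = blocks G])%E].
Proof.
exists (fun n p K s hK => sparse_kmeans s hK) => a a0.
(* With [hh = a L^a] and [tau = 128 L], the factor [64 * 128 * hh^3 * tau^6] is this constant times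
   [L^(3 a + 6)]. *)
exists (64 * 128 * a ^+ 3 * 128 ^+ 6), (a * 3 + 6); split.
- by do 2 (apply: mulr_gt0; last exact: exprn_gt0).
- by apply: addr_gt0 => //; exact: mulr_gt0.
move=> n p K s hK d Omega P Y U sigma J mu G eta gamma sp sigma0 model _ _ eta1 gamma1 hom bal
  etah gammah SM.
have [_ [Js muJ] _ _] := model.
have [h0 [GE hs XE gY]] := model_labels model.
pose h : {ffun 'I_n -> 'I_K} := [ffun i => h0 i].
have hE : h0 = h by apply/funext => i; rewrite ffunE.
rewrite {}hE in GE hs XE; rewrite {}GE in hom bal gY XE *.
have L0 : 0 < ln (n * p)%:R :> R.
  have /andP[K1 Kn] := hK; have /andP[s0 sp'] := sp.
  by have : 2 <= (n * p)%:R :> R by [rewrite ler_nat; nia]; move/ln_ge_half; lra.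
set L := ln _ in etah gammah SM L0.
have hhE : 64 * 128 * a ^+ 3 * 128 ^+ 6 * L `^ (a * 3 + 6) =
    64 * 128 * (a * L `^ a) ^+ 3 * tau_of n p ^+ 6.
  rewrite powRD; last by rewrite (gt_eqF L0) implybT.
  rewrite powRrM !powR_mulrn ?powR_ge0 ?(ltW L0)// /tau_of -/L.
  by rewrite !exprMn; ring.
rewrite hhE in SM.
have sep k k' : k != k' ->
    2 * (sigma ^+ 2 * separation2 mu sigma) <= \sum_j (mu k j - mu k' j) ^+ 2.
  exact: separation2_le.
have fail := kmeans_success (default_labelling hK) hK sp sigma0 gY XE hs muJ Js sep
  gamma1 eta1 gammah etah (balanced_fsize hs bal) hom SM.
pose A := [set w | kmeans s (column_price n p K s) (default_labelling hK) (Y w, tt) = label_blocks h].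
have mA : measurable A.
  have mYt : measurable_fun setT (fun w => (Y w, tt)).
    by apply: measurable_fun_pair => //; exact: measurable_funPT.
  rewrite -[X in measurable X]setTI.
  exact: (mYt measurableT _ (measurable_kmeans s _ _ (label_blocks h))).
have PA : (1 - P A <= (4 / n%:R ^+ 2)%:E)%E by rewrite -probability_setC.
(* [kmeans] reads only the data component, so the two events are convertible. *)
rewrite (_ : [set w | _] = A)//.
have PAf : P A \is a fin_num by exact: fin_num_measure.
move: PA; rewrite -(fineK PAf) -EFinB !lee_fin; lra.
Qed.
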